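(* Let $p,r,q$ be coefficient functions as in the context, with associated potential $Q$, change of variable $l:[A,B]\to[a,b]$, $l(y_0)=x_0$, and $\rho=(pr)^{1/4}$. Assume that the equation $(p(y)g')'-q(y)g=0$ possesses a particular solution $g$ on $(A,B)$ such that $g^2r$ and $1/(g^2p)$ are continuous on $[A,B]$, and hence the function $f$ defined by $f(x):=f(l(y))=\rho(y)g(y)$, $x=l(y)$, is a particular solution of $f''-Q(x)f=0$ on $(a,b)$. Let $\Phi_n$ be the formal powers constructed from $g$ with base point $y_0$, and let $\varphi_n$ be the formal powers constructed from $f$ with base point $x_0=l(y_0)$. Then $$\rho(y)\Phi_n(y)=\varphi_n(x),\qquad x=l(y),\quad\text{for all } n\in\mathbb{N}\cup\{0\},$$ that is, $\varphi_n=L[\Phi_n]$, where $L$ is the Liouville transformation $L[v](x)=\rho(l^{-1}(x))\,v(l^{-1}(x))$.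
   Context: Coefficients. $(A,B)$ is a finite real interval; $AC_{loc}(A,B)$ denotes the complex-valued functions absolutely continuous on every compact subinterval of $(A,B)$. The functions $p,r:(A,B)\to\mathbb{R}$ satisfy $p,p',r,r'\in AC_{loc}(A,B)$ and $p(y),r(y)>0$ on $(A,B)$; they extend to continuous positive functions on $[A,B]$. The function $q$ on $(A,B)$ may be complex-valued. Put $\rho(y)=(p(y)r(y))^{1/4}$. Change of variable. Fix $y_0\in(A,B)$, $x_0\in\mathbb{R}$ and let $l(y)=x_0+\int_{y_0}^{y}\{r(s)/p(s)\}^{1/2}ds$, $a=l(A)$, $b=l(B)$ (finite). Then $l:[A,B]\to[a,b]$ is a bijection. The Liouville transformation is $L:C[A,B]\to C[a,b]$, $L[v](x)=\rho(l^{-1}(x))v(l^{-1}(x))$. Potential. With $x=l(y)$, $Q(x)=r(y)^{-1}q(y)-\{r(y)^{-3}p(y)\}^{1/4}\bigl[p(y)(\{p(y)r(y)\}^{-1/4})'\bigr]'$, where primes are derivatives in $y$ (existing almost everywhere). Solutions. A solution $g$ of $(pg')'-qg=0$ on $(A,B)$ is a complex-valued function with $g,pg'\in AC_{loc}(A,B)$ satisfying the equation almost everywhere; similarly for $f''-Qf=0$. Formal powers for $g$. Set $\widetilde Y^{(0)}\equiv Y^{(0)}\equiv 1$ and, for $k\ge1$, $\widetilde Y^{(k)}(y)=k\int_{y_0}^{y}\widetilde Y^{(k-1)}(s)g^2(s)r(s)\,ds$ for $k$ odd, $\widetilde Y^{(k)}(y)=k\int_{y_0}^{y}\widetilde Y^{(k-1)}(s)\frac{1}{g^2(s)p(s)}\,ds$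 for $k$ even; $Y^{(k)}(y)=k\int_{y_0}^{y}Y^{(k-1)}(s)\frac{1}{g^2(s)p(s)}\,ds$ for $k$ odd, $Y^{(k)}(y)=k\int_{y_0}^{y}Y^{(k-1)}(s)g^2(s)r(s)\,ds$ for $k$ even. Then $\Phi_k=gY^{(k)}$ for $k$ odd and $\Phi_k=g\widetilde Y^{(k)}$ for $k$ even. Formal powers for $f$. Set $\widetilde X^{(0)}\equiv X^{(0)}\equiv1$ and, for $n\ge1$, $\widetilde X^{(n)}(x)=n\int_{x_0}^{x}\widetilde X^{(n-1)}(s)\bigl(f^2(s)\bigr)^{(-1)^{n-1}}ds$, $X^{(n)}(x)=n\int_{x_0}^{x}X^{(n-1)}(s)\bigl(f^2(s)\bigr)^{(-1)^{n}}ds$. Then $\varphi_k=fX^{(k)}$ for $k$ odd and $\varphi_k=f\widetilde X^{(k)}$ for $k$ even. *)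

(* Defs.v *)
From Stdlib Require Import Reals ClassicalEpsilon.
From Coquelicot Require Import Coquelicot.
Open Scope R_scope.

Definition cc (A B y : R) : Prop := A <= y <= B.
Definition oo (A B y : R) : Prop := A < y < B.

(* Lebesgue-null subsets of R, by countable covers of small total length. *)
Definition null_set (E : R -> Prop) : Prop :=
  forall eps : R, 0 < eps ->
  exists u v : nat -> R,
    (forall k, u k <= v k) /\
    (forall x, E x -> exists k, u k < x < v k) /\
    (forall n, sum_n (fun k => v k - u k) n <= eps).

Definition ae (A B : R) (P : R -> Prop) : Prop :=
  null_set (fun y => oo A B y /\ ~ P y).

(* [sum_n h n] is the sum of the n+1 terms h 0, ..., h n. *)
Definition AC {V : NormedModule R_AbsRing} (h : R -> V) (c d : R) : Prop :=
  forall eps : R, 0 < eps ->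
  exists delta : R, 0 < delta /\
  forall (n : nat) (u v : nat -> R),
    (forall i, (i <= n)%nat -> c <= u i /\ u i <= v i /\ v i <= d) ->
    (forall i j, (i <= n)%nat -> (j <= n)%nat -> i <> j ->
       v i <= u j \/ v j <= u i) ->
    sum_n (fun i => v i - u i) n < delta ->
    sum_n (fun i => norm (minus (h (v i)) (h (u i)))) n < eps.

Definition AC_loc {V : NormedModule R_AbsRing} (h : R -> V) (A B : R) : Prop :=
  forall c d : R, A < c -> c <= d -> d < B -> AC h c d.

(* C as a real normed space; Coquelicot's canonical structures on C are those
   over C itself, so this one has to be given explicitly. *)
Notation CR := C_R_NormedModule.

(* p' and r' are given through representatives p1, r1 of the almost everywhere
   derivatives.  Here p, r are the functions already extended to [A,B]. *)
Definition coefficients (A B : R) (p r : R -> R) : Prop :=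
  (AC_loc p A B /\
   exists p1 : R -> R,
     ae A B (fun y => is_derive p y (p1 y)) /\ AC_loc p1 A B) /\
  (AC_loc r A B /\
   exists r1 : R -> R,
     ae A B (fun y => is_derive r y (r1 y)) /\ AC_loc r1 A B) /\
  continuous_on (cc A B) p /\ continuous_on (cc A B) r /\
  (forall y, cc A B y -> 0 < p y) /\ (forall y, cc A B y -> 0 < r y).

(* (p g')' - q g = 0 on (A,B); g1 is the almost everywhere derivative g', in
   the representative for which p g' is locally absolutely continuous. *)
Definition is_solution (A B : R) (p : R -> R) (q g : R -> C) : Prop :=
  AC_loc (V := CR) g A B /\
  exists g1 : R -> C,
    ae A B (fun y => is_derive (V := CR) g y (g1 y)) /\
    AC_loc (V := CR) (fun y => (RtoC (p y) * g1 y)%C) A B /\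
    ae A B (fun y => exists d : C,
      is_derive (V := CR) (fun t => (RtoC (p t) * g1 t)%C) y d /\
      (d - q y * g y)%C = RtoC 0).

Definition rho (p r : R -> R) (y : R) : R := Rpower (p y * r y) (1 / 4).

Definition ell (p r : R -> R) (y0 x0 y : R) : R :=
  x0 + RInt (fun s => sqrt (r s / p s)) y0 y.

(* The inverse of ell : [A,B] -> [ell A, ell B]; unspecified elsewhere. *)
Definition ell_inv (A B : R) (p r : R -> R) (y0 x0 x : R) : R :=
  epsilon (inhabits 0) (fun y => cc A B y /\ ell p r y0 x0 y = x).

Definition Liouville (A B : R) (p r : R -> R) (y0 x0 : R) (v : R -> C)
    (x : R) : C :=
  let y := ell_inv A B p r y0 x0 x in (RtoC (rho p r y) * v y)%C.

Definition potential (A B : R) (p r : R -> R) (q : R -> C) (y0 x0 : R)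
    (x : R) : C :=
  let y := ell_inv A B p r y0 x0 x in
  (RtoC (/ r y) * q y -
   RtoC (Rpower (/ (r y ^ 3) * p y) (1 / 4) *
         Derive (fun t =>
           p t * Derive (fun s => Rpower (p s * r s) (- (1 / 4))) t) y)%R)%C.

(* Iterated integrals from c: step k uses the weight w1 for k odd and w2 for
   k even. *)
Fixpoint iterated (w1 w2 : R -> C) (c : R) (k : nat) (y : R) : C :=
  match k with
  | O => RtoC 1
  | S m =>
      (RtoC (INR (S m)) *
       RInt (V := C_R_CompleteNormedModule)
         (fun s => iterated w1 w2 c m s *
                   (if Nat.odd (S m) then w1 s else w2 s)) c y)%C
  end.

Definition g2r (r : R -> R) (g : R -> C) (y : R) : C :=
  (g y * g y * RtoC (r y))%C.
Definition inv_g2p (p : R -> R) (g : R -> C) (y : R) : C :=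
  (/ (g y * g y * RtoC (p y)))%C.

Definition Ytilde (p r : R -> R) (g : R -> C) (y0 : R) : nat -> R -> C :=
  iterated (g2r r g) (inv_g2p p g) y0.
Definition Y (p r : R -> R) (g : R -> C) (y0 : R) : nat -> R -> C :=
  iterated (inv_g2p p g) (g2r r g) y0.

Definition Phi (p r : R -> R) (g : R -> C) (y0 : R) (k : nat) (y : R) : C :=
  (g y * (if Nat.odd k then Y p r g y0 k y else Ytilde p r g y0 k y))%C.

Definition sq (f : R -> C) (x : R) : C := (f x * f x)%C.
Definition inv_sq (f : R -> C) (x : R) : C := (/ (f x * f x))%C.

Definition Xtilde (f : R -> C) (x0 : R) : nat -> R -> C :=
  iterated (sq f) (inv_sq f) x0.
Definition X (f : R -> C) (x0 : R) : nat -> R -> C :=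
  iterated (inv_sq f) (sq f) x0.

Definition phi (f : R -> C) (x0 : R) (k : nat) (x : R) : C :=
  (f x * (if Nat.odd k then X f x0 k x else Xtilde f x0 k x))%C.

(* Main.v *)
Require Import Defs.
From Stdlib Require Import Reals Lra Lia List FinFun.
From Stdlib Require Import ClassicalEpsilon Cantor.
From Coquelicot Require Import Coquelicot.
Open Scope R_scope.
Set Bullet Behavior "Strict Subproofs".

(** Write [L] for [sqrt (r / p)], the derivative of [l = ell], and [h] for
    [1 / rho]; then [rho ^ 2 = L * p], [r = L ^ 2 * p].

    The identity of the formal powers is the change of variable [x = l y]:
    [f ^ 2 dx = rho ^ 2 g ^ 2 L dy = g ^ 2 r dy] and
    [dx / f ^ 2 = dy / (g ^ 2 p)], so by induction the iterated integrals built
    from [f] at [l y] are those built from [g] at [y]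
    ([iterated_pullback]), and [f = rho * g].  To have functions that are continuous
    on the whole line, coefficients and weights are continued as constants
    beyond the closed interval ([ell_extension], [weight_extension]).

    That [f] solves [f'' = Q f] is the computation
      [f' = (p g') h - g (p h')],   [f'' = ((p g')' h - g (p h')') / L],
    in which [p] is never differentiated alone
    ([is_derive_liouville], [is_derive_wronskian]).  Since solutions are
    understood almost everywhere, it needs two facts on locally absolutely
    continuous functions.

    If the derivative of such a function has almost everywhere a continuous
    representative, the function is continuously differentiable
    ([AC_loc_is_derive]): an absolutely continuous function with almost
    everywhere zero derivative is constant ([AC_constant]).  This makes [p], [r]
    and [g] continuously differentiable.

    The potential contains [(p h')'], where [p h'] is only absolutely
    continuous: its differentiability almost everywhere is Lebesgue's theorem
    ([AC_loc_derivable_ae]).  The points where a function [F] of bounded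
    variation fails to be differentiable are those where its slopes are
    unbounded, and those where [F] minus some linear function keeps rising and
    falling at a fixed rate.  In both cases each such point lies in short
    intervals on which a monotone function of small total growth grows at rate
    at least one ([steep_null], [oscillation_null]), and Vitali's covering
    argument bounds the outer measure by five times that growth
    ([vitali_cover]).

    Exceptional sets in [y] and in [x] correspond because [l] is bilipschitz
    ([null_image]). *)

Lemma choice {T U : Type} (P : T -> U -> Prop) :
  (forall x, exists y, P x y) -> exists h, forall x, P x (h x).
Proof.
  intros H. exists (fun x => proj1_sig (constructive_indefinite_description _ (H x))).
  intros x. apply proj2_sig.
Qed.

Ltac eq_at T := match goal with |- ?a = ?b => change (@eq T a b) end.

Lemma sum_n_S (a : nat -> R) (n : nat) : sum_n a (S n) = sum_n a n + a (S n).
Proof. rewrite sum_Sn; reflexivity. Qed.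

Lemma sum_n_le_loc (a b : nat -> R) (n : nat) :
  (forall k, (k <= n)%nat -> a k <= b k) -> sum_n a n <= sum_n b n.
Proof.
  induction n as [|n IH]; intros H.
  - rewrite !sum_O; apply H; lia.
  - rewrite !sum_n_S. apply Rplus_le_compat; [apply IH; intros; apply H; lia | apply H; lia].
Qed.

Lemma sum_n_nonneg (a : nat -> R) (n : nat) :
  (forall k, (k <= n)%nat -> 0 <= a k) -> 0 <= sum_n a n.
Proof.
  induction n as [|n IH]; intros H.
  - rewrite sum_O; apply H; lia.
  - rewrite sum_n_S. apply Rplus_le_le_0_compat; [apply IH; intros; apply H; lia | apply H; lia].
Qed.

Lemma sum_n_scal (c : R) (a : nat -> R) (n : nat) :
  sum_n (fun k => c * a k) n = c * sum_n a n.
Proof. exact (sum_n_mult_l (K := R_Ring) c a n). Qed.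

Lemma sum_n_add (a b : nat -> R) (n : nat) :
  sum_n (fun k => a k + b k) n = sum_n a n + sum_n b n.
Proof. exact (sum_n_plus (G := R_AbelianMonoid) a b n). Qed.

(** * Outer measure by countable covers *)

Definition cover_le (E : R -> Prop) (m : R) : Prop :=
  exists u v : nat -> R,
    (forall k, u k <= v k) /\
    (forall x, E x -> exists k, u k < x < v k) /\
    (forall n, sum_n (fun k => v k - u k) n <= m).

Lemma cover_le_subset (E F : R -> Prop) (m m' : R) :
  (forall x, E x -> F x) -> m <= m' -> cover_le F m -> cover_le E m'.
Proof.
  intros HEF Hm (u & v & Huv & Hc & Hs).
  exists u, v; split; [|split]; auto.
  intros n; apply Rle_trans with m; auto.
Qed.

Lemma null_subset (E F : R -> Prop) :
  (forall x, E x -> F x) -> null_set F -> null_set E.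
Proof.
  intros HEF HF eps Heps.
  apply (cover_le_subset E F eps eps); auto with real. exact (HF eps Heps).
Qed.

Definition list_sum {T : Type} (a : T -> R) (l : list T) : R :=
  fold_right (fun t s => a t + s) 0 l.

Lemma list_sum_app {T} (a : T -> R) l1 l2 :
  list_sum a (l1 ++ l2) = list_sum a l1 + list_sum a l2.
Proof. induction l1 as [|t l1 IH]; simpl; [ring | rewrite IH; ring]. Qed.

Lemma list_sum_incl {T} (a : T -> R) (l1 l2 : list T) :
  (forall t, 0 <= a t) -> NoDup l1 -> incl l1 l2 -> list_sum a l1 <= list_sum a l2.
Proof.
  intros Ha; revert l2; induction l1 as [|t l1 IH]; intros l2 Hnd Hinc.
  - simpl. clear Hinc. induction l2; simpl; [lra | specialize (Ha a0); lra].
  - inversion Hnd as [|? ? Hnin Hnd']; subst.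
    destruct (in_split t l2) as (la & lb & ->); [apply Hinc; left; reflexivity|].
    rewrite list_sum_app; simpl.
    assert (H : list_sum a l1 <= list_sum a (la ++ lb)).
    { apply IH; auto. intros s Hs.
      assert (Hs' := Hinc s (or_intror Hs)). rewrite in_app_iff in *; simpl in Hs'.
      destruct Hs' as [?|[->|?]]; auto; contradiction. }
    rewrite list_sum_app in H. lra.
Qed.

Lemma list_sum_seq (a : nat -> R) (n : nat) :
  list_sum a (seq 0 (S n)) = sum_n a n.
Proof.
  induction n as [|n IH].
  - rewrite sum_O; simpl; ring.
  - rewrite sum_n_S, <- IH, (seq_S (S n)), list_sum_app; simpl; ring.
Qed.

Lemma list_sum_map {T U} (f : T -> U) (a : U -> R) l :
  list_sum a (map f l) = list_sum (fun t => a (f t)) l.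
Proof. induction l as [|t l IH]; simpl; [|rewrite IH]; reflexivity. Qed.

Lemma list_sum_prod {T U} (a : T * U -> R) l1 l2 :
  list_sum a (list_prod l1 l2) =
  list_sum (fun t => list_sum (fun s => a (t, s)) l2) l1.
Proof.
  induction l1 as [|t l1 IH]; simpl; [reflexivity|].
  rewrite list_sum_app, list_sum_map, IH; reflexivity.
Qed.

(** Countable subadditivity: the intervals of all the covers are listed along
    Cantor's enumeration of pairs, whose first [n + 1] values lie in the square
    of side [n + 1]. *)
Lemma cover_le_countable_union (E : nat -> R -> Prop) (m : nat -> R) (M : R) :
  (forall i, cover_le (E i) (m i)) -> (forall n, sum_n m n <= M) ->
  cover_le (fun x => exists i, E i x) M.
Proof.
  intros HE HM.
  destruct (choice (fun i uv => (forall k, fst uv k <= snd uv k) /\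
    (forall x, E i x -> exists k, fst uv k < x < snd uv k) /\
    (forall n, sum_n (fun k => snd uv k - fst uv k) n <= m i)))
    as [uv Huv].
  { intros i. destruct (HE i) as (u & v & H). exists (u, v); exact H. }
  set (len := fun ij : nat * nat => snd (uv (fst ij)) (snd ij) - fst (uv (fst ij)) (snd ij)).
  exists (fun k => fst (uv (fst (of_nat k))) (snd (of_nat k))),
         (fun k => snd (uv (fst (of_nat k))) (snd (of_nat k))).
  split; [|split].
  - intros k; apply (proj1 (Huv _)).
  - intros x (i & Hx). destruct (proj1 (proj2 (Huv i)) x Hx) as [k Hk].
    exists (to_nat (i, k)). rewrite cancel_of_to; exact Hk.
  - intros n. apply Rle_trans with (sum_n m n); [|apply HM].
    change (sum_n (fun k => len (of_nat k)) n <= sum_n m n).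
    rewrite <- (list_sum_seq (fun k => len (of_nat k))), <- (list_sum_map of_nat len).
    apply Rle_trans with (list_sum len (list_prod (seq 0 (S n)) (seq 0 (S n)))).
    + apply list_sum_incl.
      * intros [i k]; unfold len; simpl. specialize (proj1 (Huv i) k); lra.
      * apply Injective_map_NoDup; [|apply seq_NoDup].
        intros a b; apply of_nat_inj.
      * intros [i k] Hin. apply in_map_iff in Hin as (c & Hc & Hin).
        apply in_seq in Hin.
        assert (H := to_nat_non_decreasing i k). rewrite <- Hc, cancel_to_of in H.
        apply in_prod; apply in_seq; lia.
    + rewrite list_sum_prod, <- (list_sum_seq m).
      generalize (seq 0 (S n)) at 2 3.
      induction l as [|i l IH]; [simpl; lra|].
      simpl. apply Rplus_le_compat; [|exact IH].
      change (list_sum (fun s => len (i, s)) (seq 0 (S n)) <= m i).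
      rewrite list_sum_seq. apply (proj2 (proj2 (Huv i))).
Qed.

Lemma half_powers_sum (eps : R) (n : nat) :
  0 < eps -> sum_n (fun i => eps * (/ 2) ^ (S i)) n <= eps.
Proof.
  intros Heps.
  assert (H : sum_n (fun i => eps * (/ 2) ^ (S i)) n = eps * (1 - (/ 2) ^ (S n))).
  { induction n as [|n IH]; [rewrite sum_O; simpl; field|].
    rewrite sum_n_S, IH; simpl; field. }
  rewrite H. assert (0 < (/ 2) ^ (S n)) by (apply pow_lt; lra). nra.
Qed.

Lemma null_countable_union (E : nat -> R -> Prop) :
  (forall i, null_set (E i)) -> null_set (fun x => exists i, E i x).
Proof.
  intros HE eps Heps.
  apply (cover_le_countable_union E (fun i => eps * (/ 2) ^ (S i))).
  - intros i. apply HE. apply Rmult_lt_0_compat; [lra | apply pow_lt; lra].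
  - intros n; apply half_powers_sum; exact Heps.
Qed.

Lemma null_union (E F : R -> Prop) :
  null_set E -> null_set F -> null_set (fun x => E x \/ F x).
Proof.
  intros HE HF.
  apply null_subset with (fun x => exists i : nat, (if Nat.eqb i 0 then E else F) x).
  - intros x [H|H]; [exists O | exists 1%nat]; exact H.
  - apply null_countable_union. intros [|i]; assumption.
Qed.

Lemma null_empty (E : R -> Prop) : (forall x, ~ E x) -> null_set E.
Proof.
  intros HE eps Heps. exists (fun _ => 0), (fun _ => 0); split; [|split].
  - intros; lra.
  - intros x Hx; destruct (HE x Hx).
  - intros n. apply Rle_trans with 0; [|lra].
    apply Req_le. induction n as [|n IH]; [rewrite sum_O | rewrite sum_n_S, IH]; ring.
Qed.

Lemma null_singleton (z : R) : null_set (fun x => x = z).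
Proof.
  intros eps Heps.
  exists (fun k => z - eps * (/ 2) ^ (S k) / 2), (fun k => z + eps * (/ 2) ^ (S k) / 2).
  assert (Hp : forall k, 0 < eps * (/ 2) ^ (S k)).
  { intros k; apply Rmult_lt_0_compat; [lra | apply pow_lt; lra]. }
  split; [|split].
  - intros k; specialize (Hp k); lra.
  - intros x ->; exists O; specialize (Hp O); lra.
  - intros n. apply Rle_trans with (2 := half_powers_sum eps n Heps).
    apply sum_n_le_loc; intros; lra.
Qed.

(** A covering argument may ignore a countable set that depends on [eps]. *)
Lemma null_up_to_countable (E : R -> Prop) :
  (forall eps, 0 < eps -> exists z : nat -> R,
     cover_le (fun x => E x /\ forall i, x <> z i) eps) -> null_set E.
Proof.
  intros H eps Heps.
  destruct (H (eps / 2)) as [z Hz]; [lra|].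
  assert (Hn : cover_le (fun x => exists i, x = z i) (eps / 2)).
  { apply (null_countable_union (fun i x => x = z i)); [|lra].
    intros i; apply null_singleton. }
  apply (cover_le_subset E (fun x => exists i : nat,
    match i with O => E x /\ forall i, x <> z i | 1%nat => exists i, x = z i | _ => False end)
    eps eps); [|lra|].
  - intros x Hx. destruct (excluded_middle_informative (exists i, x = z i)) as [Hi|Hi].
    + exists 1%nat; exact Hi.
    + exists O; split; [exact Hx|]. intros i Hxi; apply Hi; exists i; exact Hxi.
  - apply (cover_le_countable_union _
      (fun i => match i with O | 1%nat => eps / 2 | _ => 0 end)).
    + intros [|[|i]]; [exact Hz | exact Hn |].
      exists (fun _ => 0), (fun _ => 0); split; [|split]; [intros; lra | tauto |].
      intros n. apply Req_le.
      induction n as [|n IH]; [rewrite sum_O | rewrite sum_n_S, IH]; ring.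
    + assert (Hs : forall n, sum_n (fun i => match i with O | 1%nat => eps / 2 | _ => 0 end)
                                (S n) = eps).
      { induction n as [|n IH]; [rewrite sum_n_S, sum_O; simpl; lra | rewrite sum_n_S, IH; simpl; lra]. }
      intros [|n]; [rewrite sum_O; lra | rewrite Hs; lra].
Qed.

(** * Vitali's covering argument for monotone functions *)

Definition nondecreasing_on (c d : R) (W : R -> R) : Prop :=
  forall s t, c <= s -> s <= t -> t <= d -> W s <= W t.

(** Nonoverlapping intervals on which [W] grows at rate at least one have total
    length at most the growth of [W].  The last interval is removed by
    flattening [W] on it. *)
Lemma total_length_le_growth (W : R -> R) (c d : R) (u v : nat -> R) (n : nat) :
  nondecreasing_on c d W ->
  (forall i, (i <= n)%nat -> c <= u i /\ u i <= v i /\ v i <= d /\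
                             v i - u i <= W (v i) - W (u i)) ->
  (forall i j, (i < j)%nat -> (j <= n)%nat -> v i <= u j \/ v j <= u i) ->
  sum_n (fun i => v i - u i) n <= W d - W c.
Proof.
  revert W; induction n as [|n IH]; intros W HW Hin Hdis.
  - rewrite sum_O. destruct (Hin O) as (H1 & H2 & H3 & H4); [lia|].
    assert (W c <= W (u O)) by (apply HW; lra).
    assert (W (v O) <= W d) by (apply HW; lra). lra.
  - rewrite sum_n_S.
    destruct (Hin (S n)) as (H1 & H2 & H3 & H4); [lia|].
    set (s := u (S n)) in *. set (t := v (S n)) in *.
    set (W' := fun x => W (Rmin x s) + W (Rmax x t)).
    assert (Hlo : forall x, x <= s -> W' x = W x + W t).
    { intros x Hx; unfold W'. rewrite Rmin_left, Rmax_right by lra; reflexivity. }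
    assert (Hhi : forall x, t <= x -> W' x = W s + W x).
    { intros x Hx; unfold W'. rewrite Rmin_right, Rmax_left by lra; reflexivity. }
    assert (H : sum_n (fun i => v i - u i) n <= W' d - W' c).
    { apply IH.
      - intros x y Hx Hxy Hy. unfold W'. apply Rplus_le_compat; apply HW;
          unfold Rmin, Rmax; repeat destruct Rle_dec; try lra.
      - intros i Hi. destruct (Hin i) as (K1 & K2 & K3 & K4); [lia|].
        repeat split; try assumption.
        destruct (Hdis i (S n)) as [Hd|Hd]; try lia; fold s t in Hd.
        + rewrite !Hlo by lra. lra.
        + rewrite !Hhi by lra. lra.
      - intros i j Hij Hj; apply Hdis; lia. }
    rewrite (Hlo c), (Hhi d) in H by lra. lra.
Qed.

Section Vitali.

Variables (W : R -> R) (c d : R).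
Hypothesis HW : nondecreasing_on c d W.
Hypothesis Hcd : c <= d.

Let steep (I : R * R) : Prop :=
  c <= fst I /\ fst I <= snd I /\ snd I <= d /\
  snd I - fst I <= W (snd I) - W (fst I).

Let apart (I J : R * R) : Prop := snd I <= fst J \/ snd J <= fst I.

Let admissible (L : list (R * R)) (I : R * R) : Prop :=
  steep I /\ forall J, In J L -> apart J I.

(** The supremum of the admissible lengths is approached within a factor [2]. *)
Lemma exists_nearly_longest (L : list (R * R)) :
  (forall J, In J L -> steep J) ->
  exists I, admissible L I /\
    forall J, admissible L J -> snd J - fst J <= 2 * (snd I - fst I).
Proof.
  intros HL.
  set (lengths := fun l => exists I, admissible L I /\ l = snd I - fst I).
  (* the degenerate interval at [c] is always admissible *)
  assert (H0 : admissible L (c, c)).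
  { split; [unfold steep; simpl; repeat split; lra|].
    intros J HJ; destruct (HL J HJ) as (? & _); right; simpl; lra. }
  destruct (completeness lengths) as [m [Hub Hlub]].
  { exists (d - c). intros l (I & [(H1 & H2 & H3 & _) _] & ->). lra. }
  { exists 0, (c, c); split; [exact H0 | simpl; ring]. }
  assert (Hm : 0 <= m).
  { apply Hub. exists (c, c); split; [exact H0 | simpl; ring]. }
  destruct (Req_dec m 0) as [->|Hm0].
  - exists (c, c); split; [exact H0|]. intros J HJ.
    assert (snd J - fst J <= 0) by (apply Hub; exists J; auto). simpl; lra.
  - destruct (excluded_middle_informative
      (exists I, admissible L I /\ m / 2 < snd I - fst I)) as [(I & HI & Hlen)|Hno].
    + exists I; split; [exact HI|]. intros J HJ.
      assert (snd J - fst J <= m) by (apply Hub; exists J; auto). lra.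
    + exfalso. assert (m <= m / 2); [|lra].
      apply Hlub. intros l (I & HI & ->).
      apply Rnot_lt_le; intro; apply Hno; exists I; auto.
Qed.

Lemma exists_greedy_sequence :
  exists u v : nat -> R,
    (forall k, steep (u k, v k)) /\
    (forall i j, (i < j)%nat -> apart (u i, v i) (u j, v j)) /\
    (forall k I, steep I -> (forall j, (j < k)%nat -> apart (u j, v j) I) ->
       snd I - fst I <= 2 * (v k - u k)).
Proof.
  destruct (choice (fun L I => (forall J, In J L -> steep J) ->
    admissible L I /\
    forall J, admissible L J -> snd J - fst J <= 2 * (snd I - fst I))) as [pick Hpick].
  { intros L. destruct (excluded_middle_informative (forall J, In J L -> steep J))
      as [HL|HL].
    - destruct (exists_nearly_longest L HL) as [I HI]; exists I; auto.
    - exists (c, c); intros HL'; contradiction. }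
  set (sel := fix sel n := match n with O => nil | S n => pick (sel n) :: sel n end).
  assert (Hsel : forall n J, In J (sel n) <-> exists j, (j < n)%nat /\ J = pick (sel j)).
  { induction n as [|n IH]; intros J.
    - simpl; split; [tauto | intros (j & Hj & _); lia].
    - change (sel (S n)) with (pick (sel n) :: sel n). simpl In. rewrite IH. split.
      + intros [<-|(j & Hj & ->)]; [exists n | exists j]; split; auto; lia.
      + intros (j & Hj & ->). destruct (Nat.eq_dec j n) as [->|Hjn]; [auto|].
        right; exists j; split; auto; lia. }
  assert (Hst : forall n J, In J (sel n) -> steep J).
  { induction n as [|n IH]; intros J HJ; [destruct HJ|].
    destruct HJ as [<-|HJ]; [|auto]. apply (Hpick (sel n) IH). }
  exists (fun k => fst (pick (sel k))), (fun k => snd (pick (sel k))).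
  split; [|split].
  - intros k. rewrite <- surjective_pairing. apply (Hpick (sel k) (Hst k)).
  - intros i j Hij. rewrite <- !surjective_pairing.
    apply (Hpick (sel j) (Hst j)). apply Hsel. exists i; auto.
  - intros k I HI Hap. apply (Hpick (sel k) (Hst k)). split; [exact HI|].
    intros J HJ; apply Hsel in HJ as (j & Hj & ->).
    rewrite (surjective_pairing (pick (sel j))). apply Hap; exact Hj.
Qed.

(** Vitali's covering argument.  The greedy intervals have total length at most
    [W d - W c]; an interval that overlaps none of them would keep all their
    lengths bounded below, so each interval overlaps a first greedy one, which
    is at least half as long and whose fivefold dilation therefore contains
    it. *)
Lemma vitali_cover (E : R -> Prop) :
  (forall x, E x -> exists s t, c <= s /\ s <= x <= t /\ t <= d /\ s < t /\
                                t - s <= W t - W s) ->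
  cover_le E (5 * (W d - W c)).
Proof.
  intros HE.
  destruct exists_greedy_sequence as (u & v & Hst & Hap & Hgr).
  assert (Hsum : forall n, sum_n (fun i => v i - u i) n <= W d - W c).
  { intros n; apply total_length_le_growth; [exact HW| |].
    - intros i _; apply (Hst i).
    - intros i j Hij _; apply (Hap i j Hij). }
  exists (fun k => u k - 2 * (v k - u k)), (fun k => v k + 2 * (v k - u k)).
  assert (Huv : forall k, u k <= v k) by (intros k; apply (Hst k)).
  split; [|split].
  - intros k; specialize (Huv k); lra.
  - intros x Hx. destruct (HE x Hx) as (s & t & Hs & Hx' & Ht & Hlt & Hlen).
    assert (Hstp : steep (s, t)) by (unfold steep; simpl; repeat split; lra).
    assert (Hfirst : forall n, (forall j, (j < n)%nat -> apart (u j, v j) (s, t)) \/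
      exists k, ~ apart (u k, v k) (s, t) /\
                forall j, (j < k)%nat -> apart (u j, v j) (s, t)).
    { induction n as [|n [IH|IH]]; [left; intros; lia | | right; exact IH].
      destruct (excluded_middle_informative (apart (u n, v n) (s, t))) as [Ha|Ha].
      - left. intros j Hj. destruct (Nat.eq_dec j n) as [->|]; [exact Ha | apply IH; lia].
      - right. exists n; auto. }
    assert (Hk : exists k, ~ apart (u k, v k) (s, t) /\
                forall j, (j < k)%nat -> apart (u j, v j) (s, t)).
    { destruct (INR_archimed (t - s) (2 * (W d - W c))) as [n Hn]; [lra|].
      destruct (Hfirst (S n)) as [Hall|Hk]; [exfalso|exact Hk].
      assert (Hs2 : sum_n (fun i => / 2 * (t - s)) n <= sum_n (fun i => v i - u i) n).
      { apply sum_n_le_loc; intros k Hk.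
        assert (H := Hgr k (s, t) Hstp). simpl in H.
        assert (t - s <= 2 * (v k - u k)) by (apply H; intros; apply Hall; lia). lra. }
      rewrite sum_n_const, S_INR in Hs2. specialize (Hsum n). nra. }
    destruct Hk as (k & Hov & Hbef). exists k.
    assert (H := Hgr k (s, t) Hstp Hbef).
    unfold apart in Hov; simpl in Hov, H.
    apply not_or_and in Hov as [Ho1 Ho2].
    apply Rnot_le_lt in Ho1; apply Rnot_le_lt in Ho2. lra.
  - intros n. apply Rle_trans with (sum_n (fun k => 5 * (v k - u k)) n).
    + apply sum_n_le_loc; intros; lra.
    + rewrite sum_n_scal. specialize (Hsum n). lra.
Qed.

End Vitali.

(** * Total variation and differentiability almost everywhere *)

(** [T] majorizes the variation of [G] on every subinterval; this is bounded
    variation in a form that glues along adjacent intervals. *)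
Definition dominates (T G : R -> R) (c d : R) : Prop :=
  forall s t, c <= s -> s <= t -> t <= d -> Rabs (G t - G s) <= T t - T s.

Definition chain (x : nat -> R) (n : nat) (s t : R) : Prop :=
  x O = s /\ x (S n) = t /\ forall i, (i <= n)%nat -> x i <= x (S i).

Definition chain_variation (G : R -> R) (x : nat -> R) (n : nat) : R :=
  sum_n (fun i => Rabs (G (x (S i)) - G (x i))) n.

Lemma chain_monotone (x : nat -> R) (n : nat) (s t : R) (i j : nat) :
  chain x n s t -> (i <= j)%nat -> (j <= S n)%nat -> x i <= x j.
Proof.
  intros (_ & _ & H) Hij; induction Hij as [|j Hij IH]; intros Hj; [lra|].
  apply Rle_trans with (x j); [apply IH; lia | apply H; lia].
Qed.

Lemma chain_bounds (x : nat -> R) (n : nat) (s t : R) (i : nat) :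
  chain x n s t -> (i <= S n)%nat -> s <= x i <= t.
Proof.
  intros H Hi. pose proof H as (H0 & H1 & _).
  rewrite <- H0 at 1. rewrite <- H1.
  split; apply (chain_monotone x n s t); auto; lia.
Qed.

Lemma chain_extend (G : R -> R) (x : nat -> R) (n : nat) (s t t' : R) :
  chain x n s t -> t <= t' ->
  exists x', chain x' (S n) s t' /\
    chain_variation G x' (S n) = chain_variation G x n + Rabs (G t' - G t).
Proof.
  intros (H0 & H1 & H) Htt'.
  exists (fun i => if Nat.leb i (S n) then x i else t').
  assert (Hin : forall i, (i <= S n)%nat ->
    (if Nat.leb i (S n) then x i else t') = x i).
  { intros i Hi. rewrite (proj2 (Nat.leb_le i (S n)) Hi); reflexivity. }
  assert (Hout : (if Nat.leb (S (S n)) (S n) then x (S (S n)) else t') = t').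
  { rewrite (proj2 (Nat.leb_gt (S (S n)) (S n))); [reflexivity | lia]. }
  split.
  - repeat split.
    + rewrite Hin by lia; exact H0.
    + exact Hout.
    + intros i Hi. destruct (Nat.eq_dec i (S n)) as [->|Hne].
      * rewrite Hout, (Hin (S n)), H1 by lia. lra.
      * rewrite !Hin by lia. apply H; lia.
  - unfold chain_variation. rewrite sum_n_S. cbv beta. rewrite Hout, (Hin (S n)), H1 by lia.
    f_equal. apply sum_n_ext_loc. intros i Hi. rewrite !Hin by lia; reflexivity.
Qed.

(** The total variation of [G] on the intervals [[c, y]]: as a supremum, it is
    nearly attained by a chain. *)
Lemma variation_function (G : R -> R) (c d M : R) :
  c <= d ->
  (forall y x n, y <= d -> chain x n c y -> chain_variation G x n <= M) ->
  exists V, dominates V G c d /\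
    forall eps, 0 < eps ->
      exists x n, chain x n c d /\ V d - V c - eps < chain_variation G x n.
Proof.
  intros Hcd HM.
  set (sums := fun y l => exists x n, chain x n c y /\ l = chain_variation G x n).
  assert (Hne : forall y, c <= y -> exists l, sums y l).
  { intros y Hy. eexists. exists (fun i => match i with O => c | _ => y end), O.
    split; [|reflexivity]. repeat split. intros [|i] Hi; lra || lia. }
  destruct (choice (fun y v => c <= y <= d -> is_lub (sums y) v)) as [V HV].
  { intros y. destruct (excluded_middle_informative (c <= y <= d)) as [Hy|Hy].
    - destruct (completeness (sums y)) as [v Hv].
      + exists M. intros l (x & n & Hx & ->). apply HM with y; [lra | exact Hx].
      + apply Hne; lra.
      + exists v; auto.
    - exists 0; tauto. }
  assert (HVc : 0 <= V c).
  { destruct (HV c) as [Hub _]; [lra|].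
    apply Rle_trans with (chain_variation G (fun _ => c) 0).
    - apply sum_n_nonneg; intros; apply Rabs_pos.
    - apply Hub. exists (fun _ => c), O; split; [|reflexivity].
      repeat split; intros; lra. }
  exists V; split.
  - intros s t Hs Hst Ht.
    destruct (HV s) as [_ Hlub]; [lra|]. destruct (HV t) as [Hub _]; [lra|].
    assert (V s <= V t - Rabs (G t - G s)); [|lra].
    apply Hlub. intros l (x & n & Hx & ->).
    destruct (chain_extend G x n c s t Hx Hst) as (x' & Hx' & Heq).
    assert (chain_variation G x' (S n) <= V t) by (apply Hub; exists x', (S n); auto).
    lra.
  - intros eps Heps. destruct (HV d) as [_ Hlub]; [lra|].
    apply Classical_Prop.NNPP. intros Hno.
    assert (V d <= V d - V c - eps); [|lra].
    apply Hlub. intros l (x & n & Hx & ->).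
    apply Rnot_lt_le. intros Hlt. apply Hno. exists x, n; auto.
Qed.

Lemma chain_variation_le (T G : R -> R) (x : nat -> R) (n : nat) (s t c d : R) :
  dominates T G c d -> c <= s -> t <= d -> chain x n s t ->
  chain_variation G x n <= T t - T s.
Proof.
  intros HT Hs Ht Hx.
  assert (Hb := fun i => chain_bounds x n s t i Hx).
  destruct Hx as (H0 & H1 & H). rewrite <- H0, <- H1. clear H0 H1.
  unfold chain_variation. induction n as [|n IH].
  - rewrite sum_O. destruct (Hb O), (Hb 1%nat); try lia.
    apply HT; try lra. apply H; lia.
  - rewrite sum_n_S.
    assert (sum_n (fun i => Rabs (G (x (S i)) - G (x i))) n <= T (x (S n)) - T (x O)).
    { apply IH; intros; [apply H | apply Hb]; lia. }
    assert (Rabs (G (x (S (S n))) - G (x (S n))) <= T (x (S (S n))) - T (x (S n))).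
    { destruct (Hb (S n)), (Hb (S (S n))); try lia. apply HT; try lra. apply H; lia. }
    lra.
Qed.

(** [W] is the excess of the variation over a function that moves with slope
    [1] or [-1] relative to [G] on each cell, the sign being that of the
    increment of [G] over the cell. *)
Lemma variation_excess (V G : R -> R) (c d : R) (x : nat -> R) (n : nat) :
  dominates V G c d -> chain x n c d ->
  exists W, nondecreasing_on c d W /\
    W d - W c = V d - V c - chain_variation G x n /\
    forall y, c < y < d -> (forall i, y <> x i) ->
      exists sigma delta, (sigma = 1 \/ sigma = -1) /\ 0 < delta /\
        forall s t, y - delta < s -> s <= t -> t < y + delta ->
          W t - W s = V t - V s - sigma * (G t - G s).
Proof.
  assert (Hsign : forall z, exists sigma, (sigma = 1 \/ sigma = -1) /\ Rabs z = sigma * z).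
  { intros z. unfold Rabs. destruct (Rcase_abs z); [exists (-1) | exists 1]; lra. }
  revert d; induction n as [|n IH]; intros d HV Hx.
  - destruct Hx as (H0 & H1 & H).
    destruct (Hsign (G d - G c)) as (sigma & Hs & Habs).
    exists (fun y => V y - sigma * G y). split; [|split].
    + intros s t Hcs Hst Htd. assert (K := HV s t Hcs Hst Htd).
      assert (sigma * (G t - G s) <= Rabs (G t - G s)); [|lra].
      unfold Rabs; destruct Rcase_abs; destruct Hs; subst; lra.
    + unfold chain_variation. rewrite sum_O, H0, H1, Habs. ring.
    + intros y Hy _. exists sigma, 1. repeat split; auto; intros; lra.
  - pose proof Hx as (H0 & H1 & H).
    set (e := x (S n)).
    assert (Hce : c <= e <= d) by (apply (chain_bounds x (S n)); auto).
    destruct (IH e) as (W & Hmon & Hgrow & Hloc).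
    { intros s t ? ? ?; apply HV; lra. }
    { split; [exact H0 | split; [reflexivity | intros; apply H; lia]]. }
    destruct (Hsign (G d - G e)) as (sigma & Hs & Habs).
    set (R0 := fun y => V y - sigma * G y).
    assert (HR : forall s t, e <= s -> s <= t -> t <= d -> R0 s <= R0 t).
    { intros s t Hcs Hst Htd. assert (K : Rabs (G t - G s) <= V t - V s).
      { apply HV; lra. }
      assert (sigma * (G t - G s) <= Rabs (G t - G s)); [|unfold R0; lra].
      unfold Rabs; destruct Rcase_abs; destruct Hs; subst; lra. }
    set (W' := fun y => if Rle_dec y e then W y else R0 y + (W e - R0 e)).
    assert (Hlo : forall y, y <= e -> W' y = W y).
    { intros y Hy; unfold W'; destruct Rle_dec; [reflexivity | contradiction]. }
    assert (Hhi : forall y, e <= y -> W' y = R0 y + (W e - R0 e)).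
    { intros y Hy; unfold W'; destruct Rle_dec; [|reflexivity].
      replace y with e by lra; ring. }
    exists W'. split; [|split].
    + intros s t Hcs Hst Htd.
      destruct (Rle_dec t e) as [Hte|Hte]; [|destruct (Rle_dec s e) as [Hse|Hse]].
      * rewrite !Hlo by lra. apply Hmon; lra.
      * rewrite (Hlo s), (Hhi t) by lra.
        assert (W s <= W e) by (apply Hmon; lra).
        assert (R0 e <= R0 t) by (apply HR; lra). lra.
      * rewrite !Hhi by lra. assert (R0 s <= R0 t) by (apply HR; lra). lra.
    + rewrite (Hlo c), (Hhi d) by lra.
      unfold chain_variation in *. rewrite sum_n_S, H1. fold e.
      rewrite Habs. unfold R0. lra.
    + intros y Hy Hyx. assert (Hye : y <> e) by apply Hyx.
      destruct (Rlt_dec y e) as [Hlt|Hnlt].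
      * destruct (Hloc y) as (sg & delta & Hsg & Hd & Heq); [lra | exact Hyx |].
        exists sg, (Rmin delta (e - y)). split; [exact Hsg|].
        assert (Hm1 := Rmin_l delta (e - y)). assert (Hm2 := Rmin_r delta (e - y)).
        split; [apply Rmin_pos; lra|].
        intros s t Hs1 Hst Ht1. rewrite !Hlo by lra. apply Heq; lra.
      * exists sigma, (y - e). split; [exact Hs|]. split; [lra|].
        intros s t Hs1 Hst Ht1. rewrite !Hhi by lra. unfold R0; ring.
Qed.

Definition slope_near (y delta : R) (P : R -> R -> Prop) : Prop :=
  exists s t, s <= y <= t /\ s < t /\ y - delta < s /\ t < y + delta /\ P s t.

(** Take a chain whose variation sum is within [e] of the total variation.
    Near a point where [G] keeps rising and falling at rate [eta], one of the
    two directions opposes the sign of the cell, and there the variation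
    exceeds the signed increment of [G] by [2 * eta] per unit length; the
    total excess being less than [e], such points have outer measure
    [O(e / eta)]. *)
Lemma oscillation_null (T G : R -> R) (c d eta : R) :
  c <= d -> dominates T G c d -> 0 < eta ->
  null_set (fun y => c < y < d /\ forall delta, 0 < delta ->
    slope_near y delta (fun s t => eta * (t - s) <= G t - G s) /\
    slope_near y delta (fun s t => G t - G s <= - eta * (t - s))).
Proof.
  intros Hcd HT Heta.
  destruct (variation_function G c d (T d - T c)) as (V & HV & Hnear); [exact Hcd| |].
  { intros y x n Hy Hx.
    assert (c <= y <= d).
    { split; [|exact Hy]. destruct (chain_bounds x n c y O Hx) as [Ha Hb]; [lia|]. lra. }
    assert (Hle := chain_variation_le T G x n c y c d HT (Rle_refl c) Hy Hx).
    assert (Rabs (G d - G y) <= T d - T y) by (apply HT; lra).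
    assert (Hp := Rabs_pos (G d - G y)). lra. }
  apply null_up_to_countable. intros eps Heps.
  destruct (Hnear (2 * eta * eps / 5)) as (x & n & Hx & Hlt).
  { apply Rdiv_lt_0_compat; [|lra].
    apply Rmult_lt_0_compat; [|lra]. apply Rmult_lt_0_compat; lra. }
  destruct (variation_excess V G c d x n HV Hx) as (W & Hmon & Hgrow & Hloc).
  exists x.
  apply (cover_le_subset _ (fun y => (c < y < d /\ forall delta, 0 < delta ->
    slope_near y delta (fun s t => eta * (t - s) <= G t - G s) /\
    slope_near y delta (fun s t => G t - G s <= - eta * (t - s))) /\
    forall i, y <> x i) (5 * (W d / (2 * eta) - W c / (2 * eta))) _).
  { auto. }
  { replace (W d / (2 * eta) - W c / (2 * eta)) with ((W d - W c) / (2 * eta)) by (field; lra).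
    apply Rmult_le_reg_r with (2 * eta / 5); [lra|].
    replace (5 * ((W d - W c) / (2 * eta)) * (2 * eta / 5)) with (W d - W c) by (field; lra).
    lra. }
  assert (Hdiv : forall a b, W a / (2 * eta) - W b / (2 * eta) = (W a - W b) / (2 * eta)).
  { intros; field; lra. }
  apply (vitali_cover (fun y => W y / (2 * eta)) c d).
  - intros s t Hs Hst Ht. apply Rmult_le_compat_r; [|apply Hmon; assumption].
    apply Rlt_le, Rinv_0_lt_compat; lra.
  - exact Hcd.
  - intros y [[Hy Hosc] Hyx].
    destruct (Hloc y Hy Hyx) as (sigma & delta & Hsg & Hd & Heq).
    set (delta' := Rmin delta (Rmin (y - c) (d - y))).
    assert (Hd' : 0 < delta') by (repeat apply Rmin_pos; lra).
    assert (K1 : delta' <= delta) by apply Rmin_l.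
    assert (K2 : delta' <= y - c) by (eapply Rle_trans; [apply Rmin_r | apply Rmin_l]).
    assert (K3 : delta' <= d - y) by (eapply Rle_trans; [apply Rmin_r | apply Rmin_r]).
    assert (Hst : exists s t, s <= y <= t /\ s < t /\ y - delta' < s /\ t < y + delta' /\
                   eta * (t - s) <= - sigma * (G t - G s)).
    { destruct (Hosc delta' Hd') as [(s & t & ? & ? & ? & ? & H1) (s' & t' & ? & ? & ? & ? & H2)].
      destruct Hsg as [->| ->]; [exists s', t' | exists s, t]; repeat split; lra. }
    destruct Hst as (s & t & Hsyt & Hlt' & Hs & Ht & Hslope).
    exists s, t. repeat split; try lra.
    rewrite Hdiv, Heq by lra.
    assert (HVst : Rabs (G t - G s) <= V t - V s) by (apply HV; lra).
    assert (- sigma * (G t - G s) <= Rabs (G t - G s)).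
    { unfold Rabs; destruct Rcase_abs; destruct Hsg; subst; lra. }
    apply Rmult_le_reg_r with (2 * eta); [lra|].
    unfold Rdiv. rewrite Rmult_assoc, Rinv_l by lra. lra.
Qed.

Lemma steep_null (T F : R -> R) (c d : R) :
  c <= d -> dominates T F c d ->
  null_set (fun y => c < y < d /\ forall K delta, 0 < delta ->
    slope_near y delta (fun s t => K * (t - s) <= Rabs (F t - F s))).
Proof.
  intros Hcd HT eps Heps.
  assert (Hmon : forall s t, c <= s -> s <= t -> t <= d -> T s <= T t).
  { intros s t Hs Hst Ht. assert (K := HT s t Hs Hst Ht).
    assert (L := Rabs_pos (F t - F s)). lra. }
  assert (HTcd : T c <= T d) by (apply Hmon; lra).
  set (K := 5 * (T d - T c + 1) / eps).
  assert (HK : 0 < K) by (apply Rdiv_lt_0_compat; lra).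
  assert (Hdiv : forall a b, T a / K - T b / K = (T a - T b) / K).
  { intros; field; lra. }
  apply (cover_le_subset _ (fun y => c < y < d /\ forall K delta, 0 < delta ->
    slope_near y delta (fun s t => K * (t - s) <= Rabs (F t - F s)))
    (5 * (T d / K - T c / K)) _).
  { auto. }
  { rewrite Hdiv. apply Rmult_le_reg_r with K; [exact HK|].
    replace (5 * ((T d - T c) / K) * K) with (5 * (T d - T c)) by (field; lra).
    replace (eps * K) with (5 * (T d - T c + 1)) by (unfold K; field; lra). lra. }
  apply (vitali_cover (fun y => T y / K) c d); [|exact Hcd|].
  - intros s t Hs Hst Ht. apply Rmult_le_compat_r; [|apply Hmon; assumption].
    apply Rlt_le, Rinv_0_lt_compat; exact HK.
  - intros y [Hy Hsteep].
    assert (Hd' : 0 < Rmin (y - c) (d - y)) by (apply Rmin_pos; lra).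
    assert (K2 := Rmin_l (y - c) (d - y)). assert (K3 := Rmin_r (y - c) (d - y)).
    destruct (Hsteep K _ Hd') as (s & t & Hsyt & Hlt & Hs & Ht & Hsl).
    exists s, t. repeat split; try lra.
    rewrite Hdiv. apply Rmult_le_reg_r with K; [exact HK|].
    unfold Rdiv. rewrite Rmult_assoc, Rinv_l by lra.
    assert (Rabs (F t - F s) <= T t - T s) by (apply HT; lra). lra.
Qed.

Lemma is_derive_iff_bound (F : R -> R) (y L : R) :
  is_derive F y L <->
  forall eps, 0 < eps -> exists delta, 0 < delta /\
    forall z, Rabs (z - y) < delta ->
      Rabs (F z - F y - L * (z - y)) <= eps * Rabs (z - y).
Proof.
  assert (Hq : forall h, h <> 0 ->
    Rabs ((F (y + h) - F y) / h - L) = Rabs (F (y + h) - F y - L * h) / Rabs h).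
  { intros h Hh. rewrite <- Rabs_div by exact Hh. f_equal. field; exact Hh. }
  rewrite is_derive_Reals. split; intros H eps Heps.
  - destruct (H eps Heps) as [delta Hd].
    exists delta. split; [apply cond_pos|]. intros z Hz.
    destruct (Req_dec z y) as [->|Hzy].
    + rewrite !Rminus_diag, Rmult_0_r, Rminus_0_r, Rabs_R0. lra.
    + assert (Hh : z - y <> 0) by lra.
      assert (Hp : 0 < Rabs (z - y)) by (apply Rabs_pos_lt; exact Hh).
      specialize (Hd (z - y) Hh Hz). rewrite (Hq _ Hh) in Hd.
      replace (y + (z - y)) with z in Hd by ring.
      apply (Rmult_lt_compat_r (Rabs (z - y))) in Hd; [|exact Hp].
      unfold Rdiv in Hd. rewrite Rmult_assoc, Rinv_l in Hd by lra. lra.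
  - destruct (H (eps / 2)) as (delta & Hd & Hb); [lra|].
    exists (mkposreal delta Hd). intros h Hh Hlt; simpl in Hlt.
    assert (Hp : 0 < Rabs h) by (apply Rabs_pos_lt; exact Hh).
    rewrite (Hq _ Hh). specialize (Hb (y + h)).
    replace (y + h - y) with h in Hb by ring. specialize (Hb Hlt).
    apply Rmult_lt_reg_r with (Rabs h); [exact Hp|].
    unfold Rdiv. rewrite Rmult_assoc, Rinv_l by lra. nra.
Qed.

(** Differentiability from slopes over intervals that contain the point, the
    form in which a covering argument produces them. *)
Lemma is_derive_of_slopes (F : R -> R) (y L : R) :
  (forall eps, 0 < eps -> exists delta, 0 < delta /\
     forall s t, s <= y <= t -> s < t -> y - delta < s -> t < y + delta ->
       Rabs (F t - F s - L * (t - s)) <= eps * (t - s)) ->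
  is_derive F y L.
Proof.
  intros H. apply is_derive_iff_bound. intros eps Heps.
  destruct (H eps Heps) as (delta & Hd & Hs).
  exists delta. split; [exact Hd|]. intros z Hz. apply Rabs_def2 in Hz.
  destruct (Rtotal_order z y) as [Hlt|[->|Hgt]].
  - rewrite (Rabs_left (z - y)) by lra.
    replace (F z - F y - L * (z - y)) with (- (F y - F z - L * (y - z))) by ring.
    rewrite Rabs_Ropp, Ropp_minus_distr. apply Hs; lra.
  - rewrite !Rminus_diag, Rmult_0_r, Rminus_0_r, Rabs_R0. lra.
  - rewrite (Rabs_pos_eq (z - y)) by lra. apply Hs; lra.
Qed.

(** Countably many rationals, so that the exceptional set below is a countable
    union. *)
Definition grid (i j n : nat) : R := (INR i - INR j) / INR (S n).

Lemma grid_dense (L eps : R) :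
  0 < eps -> exists i j n,
    L < grid i j n - / INR (S n) /\ grid i j n + / INR (S n) < L + eps.
Proof.
  intros Heps.
  destruct (archimed_cor1 (eps / 3)) as (N & HN & HN0); [lra|].
  assert (Hn : exists n, N = S n) by (exists (pred N); lia). destruct Hn as [n ->].
  assert (Hp : 0 < INR (S n)) by (apply lt_0_INR; lia).
  set (z := up (L * INR (S n) + 1)).
  destruct (archimed (L * INR (S n) + 1)) as [Hz1 Hz2]. fold z in Hz1, Hz2.
  exists (Z.to_nat z), (Z.to_nat (- z)), n.
  assert (Hg : grid (Z.to_nat z) (Z.to_nat (- z)) n = IZR z / INR (S n)).
  { unfold grid. f_equal. rewrite !INR_IZR_INZ, <- minus_IZR. f_equal. lia. }
  rewrite Hg.
  assert (Hi : 0 < / INR (S n)) by (apply Rinv_0_lt_compat; exact Hp).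
  assert (He : / INR (S n) * INR (S n) = 1) by (apply Rinv_l; lra).
  set (w := / INR (S n)) in *. unfold Rdiv. fold w.
  assert (L = L * INR (S n) * w) by (rewrite Rmult_assoc, (Rmult_comm (INR (S n))), He; ring).
  split; nra.
Qed.

(** Off the steep points, the lower limit [L] of the slopes of [F] at [y] is
    finite.  If the slopes did not converge to [L], they would cross some small
    strip just above [L] infinitely often, and [F] minus a suitable linear
    function would oscillate at [y]. *)
Lemma dominated_derivable_ae (T F : R -> R) (c d : R) :
  c <= d -> dominates T F c d ->
  null_set (fun y => c < y < d /\ ~ ex_derive F y).
Proof.
  intros Hcd HT.
  set (osc := fun i j n y => c < y < d /\ forall delta, 0 < delta ->
    slope_near y delta (fun s t => / INR (S n) * (t - s) <=
      (F t - grid i j n * t) - (F s - grid i j n * s)) /\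
    slope_near y delta (fun s t => (F t - grid i j n * t) - (F s - grid i j n * s)
      <= - / INR (S n) * (t - s))).
  apply null_subset with (fun y =>
    (c < y < d /\ forall K delta, 0 < delta ->
       slope_near y delta (fun s t => K * (t - s) <= Rabs (F t - F s)))
    \/ exists i j n, osc i j n y).
  2: { apply null_union; [apply steep_null with T; assumption|].
       apply null_countable_union; intros i.
       apply null_countable_union; intros j.
       apply null_countable_union; intros n.
       apply (oscillation_null (fun x => T x + Rabs (grid i j n) * x)
                (fun x => F x - grid i j n * x)).
       - exact Hcd.
       - intros s t Hs Hst Ht. assert (K := HT s t Hs Hst Ht).
         replace (F t - grid i j n * t - (F s - grid i j n * s))
           with (F t - F s + - (grid i j n * (t - s))) by ring.
         eapply Rle_trans; [apply Rabs_triang|].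
         rewrite Rabs_Ropp, Rabs_mult, (Rabs_pos_eq (t - s)) by lra. lra.
       - apply Rinv_0_lt_compat, lt_0_INR; lia. }
  intros y [Hy Hnd]. apply Classical_Prop.NNPP; intros Hno. apply Hnd; clear Hnd.
  apply not_or_and in Hno as [Hns Hno].
  set (low := fun m => exists delta, 0 < delta /\
     forall s t, s <= y <= t -> s < t -> y - delta < s -> t < y + delta ->
       m * (t - s) <= F t - F s).
  assert (Hbd : exists K delta, 0 < delta /\
     forall s t, s <= y <= t -> s < t -> y - delta < s -> t < y + delta ->
       Rabs (F t - F s) < K * (t - s)).
  { apply Classical_Prop.NNPP; intros Hn. apply Hns. split; [exact Hy|].
    intros K delta Hd. apply Classical_Prop.NNPP; intros Hn'. apply Hn.
    exists K, delta. split; [exact Hd|]. intros s t H1 H2 H3 H4.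
    apply Rnot_le_lt. intros H5. apply Hn'. exists s, t. tauto. }
  destruct Hbd as (K & d0 & Hd0 & HK).
  destruct (completeness low) as [L [Hub Hlub]].
  { exists K. intros m (delta & Hd & Hm).
    set (t := y + Rmin d0 delta / 2).
    assert (0 < Rmin d0 delta) by (apply Rmin_pos; lra).
    assert (K1 := Rmin_l d0 delta). assert (K2 := Rmin_r d0 delta).
    assert (H1 := Hm y t). assert (H2 := HK y t). unfold t in *.
    assert (Hs1 := H1 ltac:(lra) ltac:(lra) ltac:(lra) ltac:(lra)).
    assert (Hs2 := H2 ltac:(lra) ltac:(lra) ltac:(lra) ltac:(lra)).
    apply Rabs_def2 in Hs2. nra. }
  { exists (- K), d0. split; [exact Hd0|]. intros s t H1 H2 H3 H4.
    assert (H5 := HK s t H1 H2 H3 H4). apply Rabs_def2 in H5. lra. }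
  exists L. apply is_derive_of_slopes. intros eps Heps.
  assert (Hlow : low (L - eps)).
  { apply Classical_Prop.NNPP; intros Hn.
    assert (L <= L - eps); [|lra]. apply Hlub. intros m (delta & Hd & Hm).
    apply Rnot_lt_le; intros Hlt. apply Hn. exists delta. split; [exact Hd|].
    intros s t H1 H2 H3 H4. assert (H5 := Hm s t H1 H2 H3 H4). nra. }
  destruct (grid_dense L eps Heps) as (i & j & n & Hg1 & Hg2).
  set (m := grid i j n) in *. set (eta := / INR (S n)) in *.
  assert (Hup : exists delta, 0 < delta /\
     forall s t, s <= y <= t -> s < t -> y - delta < s -> t < y + delta ->
       F t - F s <= (m + eta) * (t - s)).
  { apply Classical_Prop.NNPP; intros Hn.
    apply Hno. exists i, j, n. split; [exact Hy|].
    intros delta Hd. fold m eta. split.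
    - apply Classical_Prop.NNPP; intros Hn'. apply Hn. exists delta. split; [exact Hd|].
      intros s t H1 H2 H3 H4. apply Rnot_lt_le; intros H5.
      apply Hn'. exists s, t. repeat split; try tauto; lra.
    - apply Classical_Prop.NNPP; intros Hn'.
      (* otherwise all slopes near [y] are at least [m - eta], which exceeds [L] *)
      assert (m - eta <= L); [|lra]. apply Hub. exists delta. split; [exact Hd|].
      intros s t H1 H2 H3 H4. apply Rnot_lt_le; intros H5.
      apply Hn'. exists s, t. repeat split; try tauto; lra. }
  destruct Hlow as (d1 & Hd1 & Hm1). destruct Hup as (d2 & Hd2 & Hm2).
  exists (Rmin d1 d2). split; [apply Rmin_pos; assumption|].
  assert (K1 := Rmin_l d1 d2). assert (K2 := Rmin_r d1 d2).
  intros s t H1 H2 H3 H4.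
  assert (H5 : (L - eps) * (t - s) <= F t - F s) by (apply Hm1; lra).
  assert (H6 : F t - F s <= (m + eta) * (t - s)) by (apply Hm2; lra).
  apply Rabs_le. nra.
Qed.

(** * Absolutely continuous functions *)

(** Compactness of [[c, d]] as an induction principle: an additive property of
    intervals that holds near each point holds for the whole interval. *)
Lemma interval_induction (P : R -> R -> Prop) (c d : R) :
  c <= d ->
  (forall s t u, c <= s -> s <= t -> t <= u -> u <= d -> P s t -> P t u -> P s u) ->
  (forall x, c <= x <= d -> exists delta, 0 < delta /\
     forall s t, c <= s -> s <= x <= t -> t <= d -> x - delta < s -> t < x + delta -> P s t) ->
  P c d.
Proof.
  intros Hcd Hglue Hloc.
  set (E := fun y => c <= y <= d /\ P c y).
  assert (HEc : E c).
  { split; [lra|]. destruct (Hloc c) as (delta & Hd & H); [lra|]. apply H; lra. }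
  destruct (completeness E) as [m [Hub Hlub]].
  { exists d. intros y [Hy _]; lra. }
  { exists c; exact HEc. }
  assert (Hcm : c <= m) by (apply Hub; exact HEc).
  assert (Hmd : m <= d) by (apply Hlub; intros y [Hy _]; lra).
  destruct (Hloc m) as (delta & Hd & H); [lra|].
  assert (Hex : exists y, E y /\ m - delta < y).
  { apply Classical_Prop.NNPP; intros Hn.
    assert (m <= m - delta); [|lra]. apply Hlub. intros y Hy.
    apply Rnot_lt_le; intros Hlt; apply Hn; exists y; auto. }
  destruct Hex as (y & [Hy HPy] & Hym).
  assert (Hle : y <= m) by (apply Hub; split; assumption).
  set (m' := Rmin (m + delta / 2) d).
  assert (K1 : m' <= m + delta / 2) by apply Rmin_l.
  assert (K2 : m' <= d) by apply Rmin_r.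
  assert (K3 : m <= m') by (apply Rmin_glb; lra).
  assert (HPm' : P c m').
  { apply Hglue with y; try lra; [exact HPy|]. apply H; lra. }
  assert (m' <= m) by (apply Hub; split; [lra | exact HPm']).
  replace d with m'; [exact HPm'|].
  unfold m', Rmin in *; destruct Rle_dec; lra.
Qed.

(** On intervals shorter than the [delta] of [eps = 1], the variation is at
    most [1]; dominating functions on adjacent intervals are glued. *)
Lemma AC_dominated (F : R -> R) (c d : R) :
  c <= d -> AC F c d -> exists T, dominates T F c d.
Proof.
  intros Hcd HF. destruct (HF 1 Rlt_0_1) as (delta & Hd & Hac).
  apply (interval_induction (fun s t => exists T, dominates T F s t)); [exact Hcd| |].
  - intros s t u _ Hst Htu _ [T1 H1] [T2 H2].
    set (T := fun y => if Rle_dec y t then T1 y else T2 y + (T1 t - T2 t)).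
    assert (Hlo : forall y, y <= t -> T y = T1 y).
    { intros y Hy; unfold T; destruct Rle_dec; [reflexivity | contradiction]. }
    assert (Hhi : forall y, t <= y -> T y = T2 y + (T1 t - T2 t)).
    { intros y Hy; unfold T; destruct Rle_dec; [|reflexivity].
      replace y with t by lra; ring. }
    exists T. intros x y Hx Hxy Hy.
    destruct (Rle_dec y t) as [Hyt|Hyt]; [|destruct (Rle_dec x t) as [Hxt|Hxt]].
    + rewrite !Hlo by lra. apply H1; lra.
    + rewrite (Hlo x), (Hhi y) by lra.
      assert (Rabs (F t - F x) <= T1 t - T1 x) by (apply H1; lra).
      assert (Rabs (F y - F t) <= T2 y - T2 t) by (apply H2; lra).
      replace (F y - F x) with ((F y - F t) + (F t - F x)) by ring.
      eapply Rle_trans; [apply Rabs_triang | lra].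
    + rewrite !Hhi by lra.
      assert (Rabs (F y - F x) <= T2 y - T2 x) by (apply H2; lra). lra.
  - intros x Hx. exists (delta / 2). split; [lra|].
    intros s t Hcs Hsxt Htd Hs Ht.
    destruct (variation_function F s t 1) as (V & HV & _); [lra| |exists V; exact HV].
    intros y z n Hy Hz. apply Rlt_le.
    assert (Hb := fun i => chain_bounds z n s y i Hz).
    apply (Hac n z (fun i => z (S i))).
    + intros i Hi. destruct (Hb i), (Hb (S i)); try lia.
      repeat split; try lra. apply (proj2 (proj2 Hz)); exact Hi.
    + intros i j Hi Hj Hij. destruct (Nat.lt_total i j) as [Hlt|[Heq|Hlt]]; [left|lia|right];
        apply (chain_monotone z n s y); auto; lia.
    + assert (Htel : forall k, sum_n (fun i => z (S i) - z i) k = z (S k) - z O).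
      { induction k as [|k IH]; [rewrite sum_O; reflexivity | rewrite sum_n_S, IH; lra]. }
      rewrite Htel. destruct Hz as (-> & -> & _). lra.
Qed.

(** Lebesgue's differentiation theorem; the open interval is exhausted by
    countably many compact ones. *)
Lemma AC_loc_derivable_ae (F : R -> R) (A B : R) :
  AC_loc F A B -> ae A B (fun y => ex_derive F y).
Proof.
  intros HF.
  set (c := fun n => A + (B - A) * / 2 * / INR (S n)).
  set (d := fun n => B - (B - A) * / 2 * / INR (S n)).
  apply null_subset with (fun y => exists n, A < B /\ c n < y < d n /\ ~ ex_derive F y).
  - intros y [[Hy1 Hy2] Hnd].
    destruct (archimed_cor1 (Rmin (y - A) (B - y) / (B - A))) as (N & HN & HN0).
    { apply Rdiv_lt_0_compat; [apply Rmin_pos|]; lra. }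
    exists (pred N). unfold c, d. replace (S (pred N)) with N by lia.
    assert (/ INR N * (B - A) < Rmin (y - A) (B - y)).
    { apply Rmult_lt_reg_r with (/ (B - A)); [apply Rinv_0_lt_compat; lra|].
      rewrite Rmult_assoc, Rinv_r by lra. unfold Rdiv in HN; lra. }
    assert (K1 := Rmin_l (y - A) (B - y)). assert (K2 := Rmin_r (y - A) (B - y)).
    assert (0 < / INR N) by (apply Rinv_0_lt_compat, lt_0_INR; lia).
    assert (0 < / INR N * (B - A)) by (apply Rmult_lt_0_compat; lra).
    repeat split; try exact Hnd; lra.
  - apply null_countable_union. intros n.
    destruct (Rlt_dec A B) as [HAB|HAB]; [|apply null_empty; tauto].
    assert (Hn : 0 < / INR (S n) <= 1).
    { split; [apply Rinv_0_lt_compat, lt_0_INR; lia|].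
      rewrite <- Rinv_1. apply Rinv_le_contravar; [lra|].
      change 1 with (INR 1). apply le_INR; lia. }
    assert (HcA : A < c n) by (unfold c; nra).
    assert (HdB : d n < B) by (unfold d; nra).
    assert (Hcd : c n <= d n) by (unfold c, d; nra).
    destruct (AC_dominated F (c n) (d n) Hcd) as [T HT]; [apply HF; assumption|].
    apply null_subset with (2 := dominated_derivable_ae T F (c n) (d n) Hcd HT); tauto.
Qed.

Definition increment {V : NormedModule R_AbsRing} (h : R -> V) (s t : R) : R :=
  norm (minus (h t) (h s)).

Lemma increment_pos {V : NormedModule R_AbsRing} (h : R -> V) (s t : R) :
  0 <= increment h s t.
Proof. apply norm_ge_0. Qed.

(** The rules for sums, products and components all come from a bound on the
    increments. *)
Lemma AC_of_increments {V V1 V2 : NormedModule R_AbsRing}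
    (h : R -> V) (h1 : R -> V1) (h2 : R -> V2) (c d K : R) :
  (forall s t, c <= s -> s <= t -> t <= d ->
     increment h s t <= K * (increment h1 s t + increment h2 s t)) ->
  AC h1 c d -> AC h2 c d -> AC h c d.
Proof.
  intros Hinc H1 H2 eps Heps.
  set (K' := Rabs K + 1).
  assert (HK : 0 < K') by (unfold K'; assert (H := Rabs_pos K); lra).
  assert (He : 0 < eps / (2 * K')) by (apply Rdiv_lt_0_compat; lra).
  destruct (H1 _ He) as (d1 & Hd1 & A1). destruct (H2 _ He) as (d2 & Hd2 & A2).
  exists (Rmin d1 d2). split; [apply Rmin_pos; assumption|].
  assert (M1 := Rmin_l d1 d2). assert (M2 := Rmin_r d1 d2).
  intros n u v Hin Hdis Hlen.
  assert (S1 := A1 n u v Hin Hdis ltac:(lra)).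
  assert (S2 := A2 n u v Hin Hdis ltac:(lra)).
  apply Rle_lt_trans with
    (sum_n (fun i => K' * (increment h1 (u i) (v i) + increment h2 (u i) (v i))) n).
  - apply sum_n_le_loc. intros i Hi. destruct (Hin i Hi) as (Ha & Hb & Hc).
    eapply Rle_trans; [apply Hinc; lra|].
    apply Rmult_le_compat_r.
    + assert (P1 := increment_pos h1 (u i) (v i)).
      assert (P2 := increment_pos h2 (u i) (v i)). lra.
    + unfold K'. assert (H := Rle_abs K). lra.
  - rewrite sum_n_scal, sum_n_add. fold (increment h1) (increment h2) in *.
    replace eps with (K' * (eps / (2 * K') + eps / (2 * K'))) by (field; lra).
    apply Rmult_lt_compat_l; [exact HK|].
    apply Rplus_lt_compat; assumption.
Qed.

Lemma AC_id (c d : R) : AC (fun x : R => x) c d.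
Proof.
  intros eps Heps. exists eps. split; [exact Heps|].
  intros n u v Hin _ Hlen. eapply Rle_lt_trans; [|exact Hlen].
  apply sum_n_le_loc. intros i Hi. destruct (Hin i Hi) as (_ & H & _).
  change (Rabs (v i - u i) <= v i - u i). rewrite Rabs_pos_eq; lra.
Qed.

Lemma AC_lipschitz {V : NormedModule R_AbsRing} (h : R -> V) (c d K : R) :
  (forall s t, c <= s -> s <= t -> t <= d -> increment h s t <= K * (t - s)) -> AC h c d.
Proof.
  intros H. apply AC_of_increments with (h1 := fun x : R => x) (h2 := fun x : R => x) (K := Rabs K);
    try apply AC_id.
  intros s t Hs Hst Ht. eapply Rle_trans; [apply H; assumption|].
  change (increment (fun x : R => x) s t) with (Rabs (t - s)).
  rewrite (Rabs_pos_eq (t - s)) by lra. assert (L := Rle_abs K). assert (L' := Rabs_pos K). nra.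
Qed.

Lemma AC_small_increment {V : NormedModule R_AbsRing} (h : R -> V) (c d eps : R) :
  AC h c d -> 0 < eps -> exists delta, 0 < delta /\
    forall s t, c <= s -> s <= t -> t <= d -> t - s < delta -> increment h s t < eps.
Proof.
  intros H Heps. destruct (H eps Heps) as (delta & Hd & A).
  exists delta. split; [exact Hd|]. intros s t Hs Hst Ht Hlen.
  assert (K := A O (fun _ => s) (fun _ => t)). rewrite !sum_O in K. apply K; auto.
  intros i j Hi Hj; lia.
Qed.

Lemma AC_bounded (h : R -> R) (c d : R) :
  c <= d -> AC h c d -> exists M, 0 <= M /\ forall y, c <= y <= d -> Rabs (h y) <= M.
Proof.
  intros Hcd H. destruct (AC_dominated h c d Hcd H) as [T HT].
  assert (H0 : 0 <= T d - T c).
  { eapply Rle_trans; [apply Rabs_pos | apply (HT c d); lra]. }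
  exists (Rabs (h c) + (T d - T c)). split; [assert (L := Rabs_pos (h c)); lra|].
  intros y Hy. replace (h y) with (h c + (h y - h c)) by ring.
  eapply Rle_trans; [apply Rabs_triang|].
  assert (Rabs (h y - h c) <= T y - T c) by (apply HT; lra).
  assert (L : Rabs (h d - h y) <= T d - T y) by (apply HT; lra).
  assert (L' := Rabs_pos (h d - h y)). lra.
Qed.

Lemma AC_mult (h k : R -> R) (c d : R) :
  c <= d -> AC h c d -> AC k c d -> AC (fun y => h y * k y) c d.
Proof.
  intros Hcd Hh Hk.
  destruct (AC_bounded h c d Hcd Hh) as (M & HM & Hb).
  destruct (AC_bounded k c d Hcd Hk) as (N & HN & Hb').
  apply AC_of_increments with (h1 := h) (h2 := k) (K := M + N); [|exact Hh|exact Hk].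
  intros s t Hs Hst Ht.
  change (Rabs (h t * k t - h s * k s) <= (M + N) * (Rabs (h t - h s) + Rabs (k t - k s))).
  replace (h t * k t - h s * k s) with (h t * (k t - k s) + (h t - h s) * k s) by ring.
  eapply Rle_trans; [apply Rabs_triang|]. rewrite !Rabs_mult.
  assert (B1 := Hb t ltac:(lra)). assert (B2 := Hb' s ltac:(lra)).
  assert (P1 := Rabs_pos (k t - k s)). assert (P2 := Rabs_pos (h t - h s)).
  assert (P3 := Rabs_pos (h t)). assert (P4 := Rabs_pos (k s)). nra.
Qed.

Lemma AC_plus (h k : R -> R) (c d : R) :
  AC h c d -> AC k c d -> AC (fun y => h y + k y) c d.
Proof.
  intros Hh Hk. apply AC_of_increments with (h1 := h) (h2 := k) (K := 1); [|exact Hh|exact Hk].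
  intros s t _ _ _.
  change (Rabs (h t + k t - (h s + k s)) <= 1 * (Rabs (h t - h s) + Rabs (k t - k s))).
  replace (h t + k t - (h s + k s)) with ((h t - h s) + (k t - k s)) by ring.
  eapply Rle_trans; [apply Rabs_triang|]. lra.
Qed.

Lemma AC_minus (h k : R -> R) (c d : R) :
  AC h c d -> AC k c d -> AC (fun y => h y - k y) c d.
Proof.
  intros Hh Hk. apply AC_of_increments with (h1 := h) (h2 := k) (K := 1); [|exact Hh|exact Hk].
  intros s t _ _ _.
  change (Rabs (h t - k t - (h s - k s)) <= 1 * (Rabs (h t - h s) + Rabs (k t - k s))).
  replace (h t - k t - (h s - k s)) with ((h t - h s) + - (k t - k s)) by ring.
  eapply Rle_trans; [apply Rabs_triang|]. rewrite Rabs_Ropp. lra.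
Qed.

Lemma AC_ext {V : NormedModule R_AbsRing} (h k : R -> V) (c d : R) :
  (forall y, c <= y <= d -> h y = k y) -> AC h c d -> AC k c d.
Proof.
  intros Heq H. apply AC_of_increments with (h1 := h) (h2 := h) (K := 1); [|exact H|exact H].
  intros s t Hs Hst Ht. unfold increment. rewrite !Heq by lra.
  assert (L := norm_ge_0 (minus (k t) (k s))). lra.
Qed.

Lemma AC_loc_continuous {V : NormedModule R_AbsRing} (h : R -> V) (A B y : R) :
  AC_loc h A B -> A < y < B -> continuous h y.
Proof.
  intros H Hy.
  set (c := (A + y) / 2). set (d := (y + B) / 2).
  assert (Hac : AC h c d) by (apply H; unfold c, d; lra).
  apply filterlim_locally_ball_norm. intros eps.
  destruct (AC_small_increment h c d eps Hac (cond_pos eps)) as (delta & Hd & Hs).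
  assert (Hp : 0 < Rmin delta (Rmin ((y - A) / 2) ((B - y) / 2))).
  { repeat apply Rmin_pos; lra. }
  exists (mkposreal _ Hp). intros z Hz.
  assert (K1 := Rmin_l delta (Rmin ((y - A) / 2) ((B - y) / 2))).
  assert (K2 := Rle_trans _ _ _ (Rmin_r delta _) (Rmin_l ((y - A) / 2) ((B - y) / 2))).
  assert (K3 := Rle_trans _ _ _ (Rmin_r delta _) (Rmin_r ((y - A) / 2) ((B - y) / 2))).
  change (Rabs (z - y) < Rmin delta (Rmin ((y - A) / 2) ((B - y) / 2))) in Hz.
  apply Rabs_def2 in Hz. unfold ball_norm.
  destruct (Rle_dec y z) as [Hyz|Hyz].
  - apply (Hs y z); unfold c, d; lra.
  - rewrite <- opp_minus, norm_opp. apply (Hs z y); unfold c, d; lra.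
Qed.

Lemma sum_n_concat (a b : nat -> R) (n m : nat) :
  sum_n (fun i => if Nat.leb i n then a i else b (i - S n)%nat) (n + S m) =
  sum_n a n + sum_n b m.
Proof.
  set (h := fun i => if Nat.leb i n then a i else b (i - S n)%nat).
  assert (Ha : sum_n h n = sum_n a n).
  { apply sum_n_ext_loc. intros i Hi. unfold h.
    rewrite (proj2 (Nat.leb_le i n) Hi); reflexivity. }
  assert (Hb : forall k, h (S (n + k)) = b k).
  { intros k. unfold h. rewrite (proj2 (Nat.leb_gt (S (n + k)) n)) by lia. f_equal; lia. }
  change (sum_n h (n + S m) = sum_n a n + sum_n b m).
  induction m as [|m IH]; rewrite Nat.add_succ_r, sum_n_S, Hb.
  - rewrite Nat.add_0_r, sum_O, Ha. reflexivity.
  - rewrite IH, (sum_n_S b). lra.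
Qed.

Definition clip (u v x : R) : R := Rmin (Rmax x u) v.

Lemma clip_monotone (u v s t : R) : u <= v -> s <= t -> 0 <= clip u v t - clip u v s <= v - u.
Proof.
  intros Huv Hst. unfold clip, Rmin, Rmax. repeat destruct Rle_dec; lra.
Qed.

Lemma clip_inside (u v x : R) : u <= x <= v -> clip u v x = x.
Proof. intros Hx. unfold clip, Rmin, Rmax. repeat destruct Rle_dec; lra. Qed.

(** The total length of the traces on [[s, t]] of the first [N + 1] intervals,
    counted with multiplicity; written with [clip] it is additive in [[s, t]]. *)
Definition covered_length (u v : nat -> R) (N : nat) (s t : R) : R :=
  sum_n (fun k => clip (u k) (v k) t - clip (u k) (v k) s) N.

Lemma covered_length_pos u v N s t :
  (forall k, u k <= v k) -> s <= t -> 0 <= covered_length u v N s t.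
Proof.
  intros Huv Hst. apply sum_n_nonneg. intros k _. apply clip_monotone; auto.
Qed.

Lemma covered_length_incr u v N M s t :
  (forall k, u k <= v k) -> s <= t -> (N <= M)%nat ->
  covered_length u v N s t <= covered_length u v M s t.
Proof.
  intros Huv Hst HNM. induction HNM as [|M HNM IH]; [lra|].
  unfold covered_length in *. rewrite sum_n_S.
  assert (H := proj1 (clip_monotone (u (S M)) (v (S M)) s t (Huv _) Hst)). lra.
Qed.

Lemma covered_length_chasles u v N s t r :
  covered_length u v N s t + covered_length u v N t r = covered_length u v N s r.
Proof.
  unfold covered_length. rewrite <- sum_n_add. apply sum_n_ext. intros; lra.
Qed.

(** Cut [[c, d]] into pieces that either lie near a point of zero derivative,
    where [G] varies little per unit length, or inside an interval covering the
    exceptional set; the pieces of the latter kind have small total length and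
    absolute continuity bounds the variation of [G] on them. *)
Lemma AC_constant (G : R -> R) (c d : R) (N : R -> Prop) :
  c <= d -> AC G c d -> null_set N ->
  (forall y, c <= y <= d -> ~ N y -> is_derive G y 0) -> G d = G c.
Proof.
  intros Hcd HG HN Hder.
  apply Rminus_diag_uniq. apply cond_eq. intros eps0 Heps0.
  rewrite Rminus_0_r.
  set (e := eps0 / (2 * (d - c + 1))).
  assert (He : 0 < e) by (apply Rdiv_lt_0_compat; lra).
  destruct (HG (eps0 / 2)) as (delta & Hdelta & Hac); [lra|].
  destruct (HN (delta / 2)) as (u & v & Huv & Hcov & Hsum); [lra|].
  set (P := fun s t => exists k n x y,
    (forall i, (i <= n)%nat -> s <= x i /\ x i <= y i /\ y i <= t) /\
    (forall i j, (i < j)%nat -> (j <= n)%nat -> y i <= x j) /\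
    sum_n (fun i => y i - x i) n <= covered_length u v k s t /\
    Rabs (G t - G s) <= e * (t - s) + sum_n (fun i => Rabs (G (y i) - G (x i))) n).
  assert (HP : P c d).
  { apply interval_induction; [exact Hcd| |].
    - intros s t r Hs Hst Htr Hr (k & n & x & y & A1 & A2 & A3 & A4)
        (k' & n' & x' & y' & B1 & B2 & B3 & B4).
      set (X := fun i => if Nat.leb i n then x i else x' (i - S n)%nat).
      set (Y := fun i => if Nat.leb i n then y i else y' (i - S n)%nat).
      assert (Hlo : forall i, (i <= n)%nat -> X i = x i /\ Y i = y i).
      { intros i Hi. unfold X, Y. rewrite (proj2 (Nat.leb_le i n) Hi); auto. }
      assert (Hhi : forall i, (n < i)%nat -> X i = x' (i - S n)%nat /\ Y i = y' (i - S n)%nat).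
      { intros i Hi. unfold X, Y. rewrite (proj2 (Nat.leb_gt i n) Hi); auto. }
      exists (Nat.max k k'), (n + S n')%nat, X, Y.
      split; [|split; [|split]].
      + intros i Hi. destruct (Compare_dec.le_lt_dec i n) as [Hin|Hin].
        * destruct (Hlo i Hin) as [-> ->]. destruct (A1 i Hin) as (? & ? & ?). lra.
        * destruct (Hhi i Hin) as [-> ->].
          destruct (B1 (i - S n)%nat) as (? & ? & ?); [lia|]. lra.
      + intros i j Hij Hj. destruct (Compare_dec.le_lt_dec j n) as [Hjn|Hjn].
        * destruct (Hlo j Hjn) as [-> _]. destruct (Hlo i) as [_ ->]; [lia|].
          apply A2; assumption.
        * destruct (Hhi j Hjn) as [-> _].
          destruct (B1 (j - S n)%nat) as (? & ? & ?); [lia|].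
          destruct (Compare_dec.le_lt_dec i n) as [Hin|Hin].
          -- destruct (Hlo i Hin) as [_ ->]. destruct (A1 i Hin) as (? & ? & ?). lra.
          -- destruct (Hhi i Hin) as [_ ->]. apply B2; lia.
      + rewrite <- (covered_length_chasles u v (Nat.max k k') s t r).
        assert (L1 := covered_length_incr u v k (Nat.max k k') s t Huv Hst ltac:(lia)).
        assert (L2 := covered_length_incr u v k' (Nat.max k k') t r Huv Htr ltac:(lia)).
        rewrite (sum_n_ext _ (fun i => if Nat.leb i n then y i - x i
                       else y' (i - S n)%nat - x' (i - S n)%nat)).
        * rewrite (sum_n_concat (fun i => y i - x i) (fun i => y' i - x' i)). lra.
        * intros i. unfold X, Y. destruct (Nat.leb i n); reflexivity.
      + rewrite (sum_n_ext _ (fun i => if Nat.leb i n then Rabs (G (y i) - G (x i))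
                       else Rabs (G (y' (i - S n)%nat) - G (x' (i - S n)%nat)))).
        * rewrite (sum_n_concat (fun i => Rabs (G (y i) - G (x i)))
                     (fun i => Rabs (G (y' i) - G (x' i)))).
          replace (G r - G s) with ((G r - G t) + (G t - G s)) by ring.
          eapply Rle_trans; [apply Rabs_triang|]. lra.
        * intros i. unfold X, Y. destruct (Nat.leb i n); reflexivity.
    - intros z Hz. destruct (excluded_middle_informative (N z)) as [Hbad|Hgood].
      + destruct (Hcov z Hbad) as [k Hk].
        exists (Rmin (z - u k) (v k - z)). split; [apply Rmin_pos; lra|].
        assert (K1 := Rmin_l (z - u k) (v k - z)). assert (K2 := Rmin_r (z - u k) (v k - z)).
        intros s t Hs Hszt Ht Hs' Ht'.
        exists k, O, (fun _ => s), (fun _ => t). rewrite !sum_O. repeat split; try lra.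
        * intros i j Hij Hj; lia.
        * apply Rle_trans with (clip (u k) (v k) t - clip (u k) (v k) s).
          { rewrite !clip_inside by lra. lra. }
          unfold covered_length. destruct k as [|k]; [rewrite sum_O; lra|].
          rewrite sum_n_S.
          assert (L := covered_length_pos u v k s t Huv ltac:(lra)).
          unfold covered_length in L. lra.
        * assert (0 <= e * (t - s)) by (apply Rmult_le_pos; lra). lra.
      + destruct (proj1 (is_derive_iff_bound G z 0) (Hder z Hz Hgood) e He) as (dl & Hdl & Hb).
        exists dl. split; [exact Hdl|].
        assert (Hnear : forall w, z - dl < w < z + dl -> Rabs (G w - G z) <= e * Rabs (w - z)).
        { intros w Hw. replace (G w - G z) with (G w - G z - 0 * (w - z)) by ring.
          apply Hb, Rabs_def1; lra. }
        intros s t Hs Hszt Ht Hs' Ht'.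
        exists O, O, (fun _ => s), (fun _ => s). rewrite !sum_O. repeat split; try lra.
        * intros i j Hij Hj; lia.
        * assert (L := covered_length_pos u v O s t Huv ltac:(lra)). lra.
        * assert (Hs1 := Hnear s ltac:(lra)). assert (Ht1 := Hnear t ltac:(lra)).
          rewrite (Rabs_pos_eq (t - z)) in Ht1 by lra.
          rewrite <- Rabs_Ropp, Ropp_minus_distr, (Rabs_left1 (s - z)) in Hs1 by lra.
          rewrite Rminus_diag, Rabs_R0.
          replace (G t - G s) with ((G t - G z) + (G z - G s)) by ring.
          eapply Rle_trans; [apply Rabs_triang|]. lra. }
  destruct HP as (k & n & x & y & A1 & A2 & A3 & A4).
  assert (Hs : sum_n (fun i => Rabs (G (y i) - G (x i))) n < eps0 / 2).
  { apply (Hac n x y A1).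
    - intros i j Hi Hj Hij. destruct (Nat.lt_total i j) as [Hl|[He'|Hl]];
        [left; apply A2; lia | lia | right; apply A2; lia].
    - eapply Rle_lt_trans; [exact A3|]. apply Rle_lt_trans with (delta / 2); [|lra].
      eapply Rle_trans; [|apply (Hsum k)].
      apply sum_n_le_loc. intros; apply clip_monotone; auto. }
  eapply Rle_lt_trans; [exact A4|].
  assert (e * (d - c) <= eps0 / 2); [|lra].
  unfold e. apply Rmult_le_reg_r with (2 * (d - c + 1)); [lra|].
  replace (eps0 / (2 * (d - c + 1)) * (d - c) * (2 * (d - c + 1))) with (eps0 * (d - c))
    by (field; lra).
  replace (eps0 / 2 * (2 * (d - c + 1))) with (eps0 * (d - c + 1)) by field. nra.
Qed.

Lemma increment_le_of_derive (h h' : R -> R) (c d M : R) :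
  (forall y, c <= y <= d -> is_derive h y (h' y)) ->
  (forall y, c <= y <= d -> Rabs (h' y) <= M) ->
  forall s t, c <= s -> s <= t -> t <= d -> Rabs (h t - h s) <= M * (t - s).
Proof.
  intros Hd HM s t Hs Hst Ht.
  destruct (MVT_gen h s t h') as (z & Hz & ->).
  - intros y Hy. rewrite Rmin_left, Rmax_right in Hy by lra. apply Hd; lra.
  - intros y Hy. rewrite Rmin_left, Rmax_right in Hy by lra.
    apply continuity_pt_filterlim, (ex_derive_continuous h). exists (h' y). apply Hd; lra.
  - rewrite Rmin_left, Rmax_right in Hz by lra.
    rewrite Rabs_mult, (Rabs_pos_eq (t - s)) by lra.
    apply Rmult_le_compat_r; [lra|]. apply HM; lra.
Qed.

Lemma continuous_bounded (h : R -> R) (c d : R) :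
  c <= d -> (forall y, c <= y <= d -> continuous h y) ->
  exists M, forall y, c <= y <= d -> Rabs (h y) <= M.
Proof.
  intros Hcd Hc.
  destruct (continuity_ab_maj (fun y => Rabs (h y)) c d Hcd) as (z & Hz & _).
  - intros y Hy. apply continuity_pt_filterlim.
    apply (continuous_comp h Rabs); [apply Hc; exact Hy | apply continuous_Rabs].
  - exists (Rabs (h z)). exact Hz.
Qed.

Lemma AC_of_continuous_derive (h h' : R -> R) (c d : R) :
  c <= d -> (forall y, c <= y <= d -> is_derive h y (h' y)) ->
  (forall y, c <= y <= d -> continuous h' y) -> AC h c d.
Proof.
  intros Hcd Hd Hc. destruct (continuous_bounded h' c d Hcd Hc) as [M HM].
  apply AC_lipschitz with M. exact (increment_le_of_derive h h' c d M Hd HM).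
Qed.

(** An absolutely continuous function whose almost everywhere derivative has a
    continuous representative differs from the primitive of that representative
    by a constant, so it is continuously differentiable. *)
Lemma AC_loc_is_derive (F F' : R -> R) (A B : R) :
  AC_loc F A B -> ae A B (fun y => is_derive F y (F' y)) ->
  (forall y, A < y < B -> continuous F' y) ->
  forall y, A < y < B -> is_derive F y (F' y).
Proof.
  intros HF Hae Hc y Hy.
  set (c := (A + y) / 2).
  assert (Hc1 : A < c < y) by (unfold c; lra).
  set (I := fun t => RInt F' c t).
  assert (HI : forall t, A < t < B -> is_derive I t (F' t)).
  { intros t Ht. apply (is_derive_RInt F' I c t).
    - assert (Hp : 0 < Rmin (t - A) (B - t)) by (apply Rmin_pos; lra).
      exists (mkposreal _ Hp). intros z Hz.
      change (Rabs (z - t) < Rmin (t - A) (B - t)) in Hz. apply Rabs_def2 in Hz.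
      assert (K1 := Rmin_l (t - A) (B - t)). assert (K2 := Rmin_r (t - A) (B - t)).
      apply (RInt_correct F' c z). apply (ex_RInt_continuous F'). intros w Hw. apply Hc.
      revert Hw; unfold Rmin, Rmax; destruct Rle_dec; lra.
    - apply Hc; exact Ht. }
  assert (Heq : forall t, c <= t -> t < B -> F t - I t = F c - I c).
  { intros t Hct HtB.
    apply (AC_constant (fun t => F t - I t) c t
             (fun y => oo A B y /\ ~ is_derive F y (F' y))); [exact Hct| |exact Hae|].
    - apply AC_minus; [apply HF; lra|].
      apply AC_of_continuous_derive with F'; [exact Hct| |]; intros w Hw; [apply HI|apply Hc]; lra.
    - intros w Hw Hgood.
      assert (Hd : is_derive F w (F' w)).
      { apply Classical_Prop.NNPP; intros Hn; apply Hgood. split; [split; lra | exact Hn]. }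
      replace 0 with (F' w - F' w) by ring.
      apply (is_derive_minus F I); [exact Hd | apply HI; lra]. }
  apply is_derive_ext_loc with (fun t => I t + (F c - I c)).
  - assert (Hp : 0 < Rmin (y - c) (B - y)) by (apply Rmin_pos; lra).
    exists (mkposreal _ Hp). intros z Hz.
    change (Rabs (z - y) < Rmin (y - c) (B - y)) in Hz. apply Rabs_def2 in Hz.
    assert (K1 := Rmin_l (y - c) (B - y)). assert (K2 := Rmin_r (y - c) (B - y)).
    rewrite <- (Heq z) by lra. lra.
  - replace (F' y) with (F' y + 0) by ring.
    apply (is_derive_plus I); [apply HI; exact Hy | apply @is_derive_const].
Qed.

(** * Complex-valued functions, componentwise *)

Lemma norm_C_bounds (z : C) :
  Rabs (fst z) <= norm (V := CR) z /\ Rabs (snd z) <= norm (V := CR) z /\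
  norm (V := CR) z <= Rabs (fst z) + Rabs (snd z).
Proof.
  destruct z as [x y]. simpl fst; simpl snd.
  change (norm (V := CR) (x, y)) with (sqrt (Rabs x ^ 2 + Rabs y ^ 2)).
  assert (Hx := Rabs_pos x). assert (Hy := Rabs_pos y).
  repeat split.
  - rewrite <- (sqrt_pow2 (Rabs x)) at 1 by exact Hx. apply sqrt_le_1_alt. nra.
  - rewrite <- (sqrt_pow2 (Rabs y)) at 1 by exact Hy. apply sqrt_le_1_alt. nra.
  - rewrite <- (sqrt_pow2 (Rabs x + Rabs y)) by lra. apply sqrt_le_1_alt. nra.
Qed.

Lemma AC_C_iff (h : R -> C) (c d : R) :
  AC (V := CR) h c d <-> AC (fun y => fst (h y)) c d /\ AC (fun y => snd (h y)) c d.
Proof.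
  split.
  - intros H; split; apply (AC_of_increments (V1 := CR) (V2 := CR) _ h h c d 1); auto;
      intros s t _ _ _;
      assert (P := increment_pos (V := CR) h s t);
      destruct (norm_C_bounds (minus (G := CR) (h t) (h s))) as (B1 & B2 & _);
      fold (increment (V := CR) h s t) in B1, B2.
    + change (Rabs (fst (minus (G := CR) (h t) (h s))) <=
              1 * (increment (V := CR) h s t + increment (V := CR) h s t)). lra.
    + change (Rabs (snd (minus (G := CR) (h t) (h s))) <=
              1 * (increment (V := CR) h s t + increment (V := CR) h s t)). lra.
  - intros [H1 H2]. apply (AC_of_increments (V := CR) h _ _ c d 1) with (2 := H1) (3 := H2).
    intros s t _ _ _. unfold increment.
    destruct (norm_C_bounds (minus (G := CR) (h t) (h s))) as (_ & _ & B).
    rewrite Rmult_1_l. exact B.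
Qed.

Lemma is_derive_C_iff (h : R -> C) (y : R) (d : C) :
  is_derive (V := CR) h y d <->
  is_derive (fun t => fst (h t)) y (fst d) /\ is_derive (fun t => snd (h t)) y (snd d).
Proof.
  split.
  - intros H; split.
    + apply (filterdiff_comp' (V := CR) (W := R_NormedModule) h fst y _ fst H).
      apply filterdiff_linear. apply (is_linear_fst (U := R_NormedModule) (V := R_NormedModule)).
    + apply (filterdiff_comp' (V := CR) (W := R_NormedModule) h snd y _ snd H).
      apply filterdiff_linear. apply (is_linear_snd (U := R_NormedModule) (V := R_NormedModule)).
  - intros [H1 H2].
    assert (Hs := is_derive_plus (V := CR) _ _ _ _ _
      (is_derive_scal_l (V := CR) _ _ _ (1, 0) H1)
      (is_derive_scal_l (V := CR) _ _ _ (0, 1) H2)).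
    replace d with (plus (G := CR) (scal (V := CR) (fst d) (1, 0)) (scal (V := CR) (snd d) (0, 1))).
    + revert Hs. apply is_derive_ext. intros t.
      destruct (h t) as [x z]; simpl. unfold plus, scal; simpl. unfold prod_plus, prod_scal; simpl.
      unfold plus, scal; simpl. unfold mult; simpl. f_equal; ring.
    + destruct d as [x z]; simpl. unfold plus, scal; simpl. unfold prod_plus, prod_scal; simpl.
      unfold plus, scal; simpl. unfold mult; simpl. f_equal; ring.
Qed.

Lemma continuous_C_of_components {T : UniformSpace} (h : T -> C) (x : T) :
  continuous (fun t => fst (h t)) x -> continuous (fun t => snd (h t)) x ->
  continuous (U := C_UniformSpace) h x.
Proof.
  intros H1 H2.
  apply (continuous_ext (fun t => (fst (h t), snd (h t)) : C_UniformSpace)).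
  { intros t. symmetry; apply surjective_pairing. }
  apply (continuous_comp_2 (fun t => fst (h t)) (fun t => snd (h t))
           (fun u v => (u, v) : C_UniformSpace) x H1 H2).
  apply (continuous_ext (fun z : prod_UniformSpace R_UniformSpace R_UniformSpace =>
           (z : C_UniformSpace))).
  { intros [u v]; reflexivity. }
  apply continuous_id.
Qed.

Lemma continuous_C_fst {T : UniformSpace} (h : T -> C) (x : T) :
  continuous (U := C_UniformSpace) h x -> continuous (fun t => fst (h t)) x.
Proof.
  intros H. apply (continuous_comp h (fst : C_UniformSpace -> R_UniformSpace)); [exact H|].
  destruct (h x); apply continuous_fst.
Qed.

Lemma continuous_C_snd {T : UniformSpace} (h : T -> C) (x : T) :
  continuous (U := C_UniformSpace) h x -> continuous (fun t => snd (h t)) x.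
Proof.
  intros H. apply (continuous_comp h (snd : C_UniformSpace -> R_UniformSpace)); [exact H|].
  destruct (h x); apply continuous_snd.
Qed.

Lemma continuous_Cmult {T : UniformSpace} (h k : T -> C) (x : T) :
  continuous (U := C_UniformSpace) h x -> continuous (U := C_UniformSpace) k x ->
  continuous (U := C_UniformSpace) (fun t => (h t * k t)%C) x.
Proof.
  intros Hh Hk.
  assert (H1 := continuous_C_fst h x Hh). assert (H2 := continuous_C_snd h x Hh).
  assert (K1 := continuous_C_fst k x Hk). assert (K2 := continuous_C_snd k x Hk).
  apply continuous_C_of_components; simpl.
  - apply (continuous_minus (V := R_NormedModule));
      apply (continuous_mult (K := R_AbsRing)); assumption.
  - apply (continuous_plus (V := R_NormedModule));
      apply (continuous_mult (K := R_AbsRing)); assumption.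
Qed.

Lemma continuous_RtoC {T : UniformSpace} (h : T -> R) (x : T) :
  continuous h x -> continuous (U := C_UniformSpace) (fun t => RtoC (h t)) x.
Proof.
  intros H. apply continuous_C_of_components; [exact H | apply continuous_const].
Qed.

(** * Continuous extension from a closed interval *)

Lemma clip_range (c d x : R) : c <= d -> cc c d (clip c d x).
Proof. intros H. unfold cc, clip, Rmin, Rmax. repeat destruct Rle_dec; lra. Qed.

Lemma clip_contracts (c d x y : R) : c <= d -> Rabs (clip c d x - clip c d y) <= Rabs (x - y).
Proof.
  intros H. unfold clip, Rmin, Rmax, Rabs.
  repeat (destruct Rle_dec || destruct Rcase_abs); lra.
Qed.

Lemma continuous_clip {U : UniformSpace} (f : R -> U) (c d : R) :
  c <= d -> continuous_on (cc c d) f -> forall x, continuous (fun t => f (clip c d t)) x.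
Proof.
  intros Hcd Hf x P HP.
  destruct (Hf (clip c d x) (clip_range c d x Hcd) P HP) as [eps He].
  exists eps. intros y Hy. apply He; [|apply clip_range; exact Hcd].
  eapply Rle_lt_trans; [apply (clip_contracts c d y x Hcd) | exact Hy].
Qed.

(** * Iterated integrals *)

Lemma continuous_primitive (h : R -> C) (c x : R) :
  (forall t, continuous (U := C_UniformSpace) h t) ->
  continuous (U := C_UniformSpace) (fun t => RInt (V := C_R_CompleteNormedModule) h c t) x.
Proof.
  intros Hh.
  apply (ex_derive_continuous (V := CR)). exists (h x).
  apply (is_derive_RInt (V := CR) h _ c x); [|apply Hh].
  apply filter_forall. intros t.
  apply (RInt_correct (V := C_R_CompleteNormedModule)).
  apply (ex_RInt_continuous (V := C_R_CompleteNormedModule)). intros z _; apply Hh.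
Qed.

Lemma iterated_continuous (w1 w2 : R -> C) (c : R) (k : nat) :
  (forall x, continuous (U := C_UniformSpace) w1 x) ->
  (forall x, continuous (U := C_UniformSpace) w2 x) ->
  forall x, continuous (U := C_UniformSpace) (iterated w1 w2 c k) x.
Proof.
  intros H1 H2. induction k as [|k IH]; intros x; cbn [iterated].
  - apply continuous_const.
  - apply continuous_Cmult; [apply continuous_const|].
    apply continuous_primitive. intros t. apply continuous_Cmult; [apply IH|].
    destruct (Nat.odd (S k)); [apply H1 | apply H2].
Qed.

Lemma between_cc (A B y0 y s : R) :
  cc A B y0 -> cc A B y -> Rmin y0 y <= s <= Rmax y0 y -> cc A B s.
Proof. unfold cc, Rmin, Rmax. intros. repeat destruct Rle_dec; lra. Qed.

Lemma iterated_ext (w1 w2 w1' w2' : R -> C) (A B c : R) (k : nat) :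
  cc A B c ->
  (forall x, cc A B x -> w1 x = w1' x) -> (forall x, cc A B x -> w2 x = w2' x) ->
  forall x, cc A B x -> iterated w1 w2 c k x = iterated w1' w2' c k x.
Proof.
  intros Hc H1 H2. induction k as [|k IH]; intros x Hx; cbn [iterated]; [reflexivity|].
  f_equal. apply RInt_ext. intros s Hs.
  assert (Hs' : cc A B s) by (apply (between_cc A B c x); auto; lra).
  rewrite IH by exact Hs'. destruct (Nat.odd (S k)); rewrite ?H1, ?H2 by exact Hs'; reflexivity.
Qed.

(** Each step is the change of variable [x = l y], [dx = l' y dy]. *)
Lemma iterated_substitution (l l' : R -> R) (v1 v2 w1 w2 : R -> C) (A B y0 : R) (k : nat) :
  (forall y, is_derive l y (l' y)) -> (forall y, continuous l' y) ->
  (forall x, continuous (U := C_UniformSpace) v1 x) ->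
  (forall x, continuous (U := C_UniformSpace) v2 x) ->
  (forall y, cc A B y -> (RtoC (l' y) * v1 (l y))%C = w1 y) ->
  (forall y, cc A B y -> (RtoC (l' y) * v2 (l y))%C = w2 y) ->
  cc A B y0 ->
  forall y, cc A B y -> iterated v1 v2 (l y0) k (l y) = iterated w1 w2 y0 k y.
Proof.
  intros Hl Hl' Hv1 Hv2 Hw1 Hw2 Hy0. induction k as [|k IH]; intros y Hy;
    cbn [iterated]; [reflexivity|].
  f_equal.
  rewrite <- (RInt_comp (V := C_R_CompleteNormedModule) _ l l').
  - apply RInt_ext. intros s Hs.
    assert (Hs' : cc A B s) by (apply (between_cc A B y0 y); auto; lra).
    rewrite <- IH by exact Hs'.
    rewrite <- (Hw1 s Hs'), <- (Hw2 s Hs').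
    rewrite scal_R_Cmult.
    eq_at C.
    destruct (Nat.odd (S k)); ring.
  - intros s _. apply continuous_Cmult; [apply iterated_continuous; assumption|].
    destruct (Nat.odd (S k)); [apply Hv1 | apply Hv2].
  - intros s _; auto.
Qed.

(** * Bilipschitz changes of variable *)

Definition bilipschitz (l : R -> R) (m M : R) : Prop :=
  0 < m /\ forall s t, s <= t -> m * (t - s) <= l t - l s <= M * (t - s).

Definition right_inverse (l k : R -> R) (A B : R) : Prop :=
  forall x, cc (l A) (l B) x -> cc A B (k x) /\ l (k x) = x.

Lemma bilipschitz_lt (l : R -> R) (m M s t : R) :
  bilipschitz l m M -> s < t -> l s < l t.
Proof.
  intros [Hm H] Hst. destruct (H s t) as [H1 _]; [lra|].
  assert (0 < m * (t - s)) by (apply Rmult_lt_0_compat; lra). lra.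
Qed.

Lemma bilipschitz_lt_iff (l : R -> R) (m M s t : R) :
  bilipschitz l m M -> l s < l t -> s < t.
Proof.
  intros H Hl. apply Rnot_le_lt. intros [Hts| ->]; [|lra].
  assert (L := bilipschitz_lt l m M t s H Hts). lra.
Qed.

Lemma inverse_increment (l k : R -> R) (A B m M : R) :
  bilipschitz l m M -> right_inverse l k A B ->
  forall x z, cc (l A) (l B) x -> cc (l A) (l B) z -> x <= z ->
    0 <= k z - k x <= / m * (z - x).
Proof.
  intros [Hm Hl] Hk x z Hx Hz Hxz.
  destruct (Hk x Hx) as [_ Ex]. destruct (Hk z Hz) as [_ Ez].
  assert (Hle : k x <= k z).
  { apply Rnot_lt_le. intros Hlt.
    assert (L := bilipschitz_lt l m M (k z) (k x) (conj Hm Hl) Hlt). lra. }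
  split; [lra|]. destruct (Hl (k x) (k z) Hle) as [H1 _]. rewrite Ex, Ez in H1.
  apply Rmult_le_reg_l with m; [exact Hm|].
  rewrite <- Rmult_assoc, Rinv_r by lra. lra.
Qed.

Lemma inverse_interior (l k : R -> R) (A B m M : R) :
  bilipschitz l m M -> right_inverse l k A B ->
  forall x, l A < x < l B -> A < k x < B.
Proof.
  intros Hl Hk x Hx. destruct (Hk x) as [_ E]; [unfold cc; lra|].
  split; apply (bilipschitz_lt_iff l m M); auto; lra.
Qed.

Lemma inverse_of_image (l k : R -> R) (A B m M : R) :
  bilipschitz l m M -> right_inverse l k A B ->
  forall y, cc A B y -> cc (l A) (l B) (l y) /\ k (l y) = y.
Proof.
  intros Hl Hk y [Hy1 Hy2].
  assert (Hc : cc (l A) (l B) (l y)).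
  { destruct Hl as [Hm Hl]. destruct (Hl A y Hy1), (Hl y B Hy2).
    assert (0 <= m * (y - A)) by (apply Rmult_le_pos; lra).
    assert (0 <= m * (B - y)) by (apply Rmult_le_pos; lra). unfold cc; lra. }
  split; [exact Hc|]. destruct (Hk _ Hc) as [_ E].
  destruct (Rtotal_order (k (l y)) y) as [H|[H|H]]; [|exact H|];
    assert (L := bilipschitz_lt l m M _ _ Hl H); lra.
Qed.

(** With [Y = k z - k x], the bound [|z - x - L Y| <= eps |Y|] is divided by
    [L]; the Lipschitz bound on [k] turns [|Y|] into [|z - x|]. *)
Lemma is_derive_inverse (l k : R -> R) (A B m M x L : R) :
  bilipschitz l m M -> right_inverse l k A B -> l A < x < l B ->
  is_derive l (k x) L -> m <= L -> is_derive k x (/ L).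
Proof.
  intros Hl Hk Hx HL HmL. pose proof Hl as [Hm Hl'].
  apply is_derive_iff_bound. intros eps Heps.
  destruct (proj1 (is_derive_iff_bound l (k x) L) HL (eps * m * L)) as (d & Hd & Hb).
  { repeat apply Rmult_lt_0_compat; lra. }
  set (d' := Rmin (d * m) (Rmin (x - l A) (l B - x))).
  assert (Hd' : 0 < d').
  { repeat apply Rmin_pos; try lra. apply Rmult_lt_0_compat; lra. }
  assert (K1 : d' <= d * m) by apply Rmin_l.
  assert (K2 : d' <= x - l A) by (eapply Rle_trans; [apply Rmin_r | apply Rmin_l]).
  assert (K3 : d' <= l B - x) by (eapply Rle_trans; [apply Rmin_r | apply Rmin_r]).
  exists d'. split; [exact Hd'|]. intros z Hz.
  assert (Hz' := Rabs_def2 _ _ Hz).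
  assert (Hcx : cc (l A) (l B) x) by (unfold cc; lra).
  assert (Hcz : cc (l A) (l B) z) by (unfold cc; lra).
  assert (Hlip : Rabs (k z - k x) <= / m * Rabs (z - x)).
  { destruct (Rle_dec x z) as [Hxz|Hxz].
    - destruct (inverse_increment l k A B m M Hl Hk x z) as [I1 I2]; auto.
      rewrite !Rabs_pos_eq by lra. exact I2.
    - destruct (inverse_increment l k A B m M Hl Hk z x) as [I1 I2]; auto; [lra|].
      rewrite !Rabs_left1 by lra. lra. }
  assert (Hnear : Rabs (k z - k x) < d).
  { eapply Rle_lt_trans; [exact Hlip|]. apply Rmult_lt_reg_l with m; [exact Hm|].
    rewrite <- Rmult_assoc, Rinv_r by lra. lra. }
  specialize (Hb (k z) Hnear).
  rewrite (proj2 (Hk z Hcz)), (proj2 (Hk x Hcx)) in Hb.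
  assert (Hb' : Rabs (z - x - L * (k z - k x)) <= eps * L * Rabs (z - x)).
  { eapply Rle_trans; [exact Hb|].
    replace (eps * L * Rabs (z - x)) with (eps * m * L * (/ m * Rabs (z - x))) by (field; lra).
    apply Rmult_le_compat_l; [|exact Hlip]. repeat apply Rmult_le_pos; lra. }
  replace (k z - k x - / L * (z - x)) with (- / L * (z - x - L * (k z - k x))) by (field; lra).
  rewrite Rabs_mult, Rabs_Ropp, Rabs_inv, (Rabs_pos_eq L) by lra.
  apply Rmult_le_reg_l with L; [lra|].
  rewrite <- Rmult_assoc, Rinv_r by lra. lra.
Qed.

(** The inverse is nondecreasing and Lipschitz, so it maps nonoverlapping
    families of intervals to nonoverlapping families of comparable length. *)
Lemma AC_loc_comp_inverse {V : NormedModule R_AbsRing} (F : R -> V)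
    (l k : R -> R) (A B m M : R) :
  bilipschitz l m M -> right_inverse l k A B ->
  AC_loc F A B -> AC_loc (fun x => F (k x)) (l A) (l B).
Proof.
  intros Hl Hk HF c d Hc Hcd Hd eps Heps.
  assert (Hinc := inverse_increment l k A B m M Hl Hk).
  assert (Hm : 0 < m) by apply Hl.
  assert (Hcc : forall x, c <= x <= d -> cc (l A) (l B) x) by (unfold cc; intros; lra).
  destruct (HF (k c) (k d)) with (eps := eps) as (delta & Hdelta & Hac); auto.
  { apply (inverse_interior l k A B m M Hl Hk); lra. }
  { destruct (Hinc c d); try apply Hcc; lra. }
  { apply (inverse_interior l k A B m M Hl Hk); lra. }
  exists (delta * m). split; [apply Rmult_lt_0_compat; lra|].
  intros n u v Hin Hdis Hlen.
  assert (Hmon : forall x z, c <= x -> x <= z -> z <= d -> k x <= k z).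
  { intros x z H1 H2 H3. destruct (Hinc x z); try apply Hcc; lra. }
  apply (Hac n (fun i => k (u i)) (fun i => k (v i))).
  - intros i Hi. destruct (Hin i Hi) as (H1 & H2 & H3).
    repeat split; apply Hmon; lra.
  - intros i j Hi Hj Hij. destruct (Hin i Hi) as (H1 & H2 & H3).
    destruct (Hin j Hj) as (H1' & H2' & H3').
    destruct (Hdis i j Hi Hj Hij); [left | right]; apply Hmon; lra.
  - apply Rle_lt_trans with (sum_n (fun i => / m * (v i - u i)) n).
    + apply sum_n_le_loc. intros i Hi. destruct (Hin i Hi) as (H1 & H2 & H3).
      apply Hinc; try apply Hcc; lra.
    + rewrite sum_n_scal. apply Rmult_lt_reg_l with m; [exact Hm|].
      rewrite <- Rmult_assoc, Rinv_r by lra. lra.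
Qed.

Lemma null_image (l : R -> R) (m M : R) (E : R -> Prop) :
  bilipschitz l m M -> null_set E -> null_set (fun x => exists y, E y /\ x = l y).
Proof.
  intros Hl HE eps Heps. pose proof Hl as [Hm Hl'].
  assert (HM : 0 < M).
  { destruct (Hl' 0 1) as [H1 H2]; lra. }
  destruct (HE (eps / M)) as (u & v & Huv & Hcov & Hsum); [apply Rdiv_lt_0_compat; lra|].
  exists (fun i => l (u i)), (fun i => l (v i)). split; [|split].
  - intros i. destruct (Hl' (u i) (v i) (Huv i)) as [H _].
    assert (0 <= m * (v i - u i)) by (apply Rmult_le_pos; specialize (Huv i); lra). lra.
  - intros x (y & Hy & ->). destruct (Hcov y Hy) as [i Hi].
    exists i. split; apply (bilipschitz_lt l m M); auto; lra.
  - intros n. apply Rle_trans with (sum_n (fun i => M * (v i - u i)) n).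
    + apply sum_n_le_loc. intros i _. apply Hl', Huv.
    + rewrite sum_n_scal. specialize (Hsum n).
      apply Rmult_le_compat_l with (r := M) in Hsum; [|lra].
      replace (M * (eps / M)) with eps in Hsum by (field; lra). exact Hsum.
Qed.

(** * The variable [ell] *)

(** [ell] on [[A, B]] is the restriction of a diffeomorphism of the line,
    obtained by continuing the coefficients as constants. *)
Lemma ell_extension (A B y0 x0 : R) (p r : R -> R) :
  oo A B y0 -> continuous_on (cc A B) p -> continuous_on (cc A B) r ->
  (forall y, cc A B y -> 0 < p y) -> (forall y, cc A B y -> 0 < r y) ->
  exists l l' m M,
    bilipschitz l m M /\
    (forall y, is_derive l y (l' y)) /\ (forall y, continuous l' y) /\
    (forall y, m <= l' y) /\ l y0 = x0 /\
    (forall y, cc A B y -> l y = ell p r y0 x0 y /\ l' y = sqrt (r y / p y)).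
Proof.
  intros [HA HB] Hp Hr Hp0 Hr0.
  assert (HAB : A <= B) by lra.
  assert (Hclip := fun y => clip_range A B y HAB).
  set (l' := fun s => sqrt (r (clip A B s) / p (clip A B s))).
  assert (Hquot : forall y, 0 < r (clip A B y) / p (clip A B y)).
  { intros y. apply Rdiv_lt_0_compat; auto. }
  assert (Hc : forall y, continuous l' y).
  { intros y. apply (continuous_comp (fun s => r (clip A B s) / p (clip A B s)) sqrt).
    - apply (continuous_mult (K := R_AbsRing)).
      + apply (continuous_clip r); assumption.
      + apply (continuous_comp (fun s => p (clip A B s)) Rinv).
        * apply (continuous_clip p); assumption.
        * apply continuous_Rinv. apply Rgt_not_eq, Hp0, Hclip.
    - apply continuous_sqrt. }
  assert (Hfix : forall y, cc A B y -> clip A B y = y).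
  { intros y Hy; apply clip_inside; exact Hy. }
  assert (Hpos : forall y, 0 < l' y) by (intros y; apply sqrt_lt_R0, Hquot).
  assert (Hext : forall y, l' (clip A B y) = l' y).
  { intros y. unfold l'. rewrite (Hfix (clip A B y)); auto. }
  destruct (continuity_ab_min l' A B HAB) as (zm & Hzm & _).
  { intros c _. apply continuity_pt_filterlim, Hc. }
  destruct (continuity_ab_maj l' A B HAB) as (zM & HzM & _).
  { intros c _. apply continuity_pt_filterlim, Hc. }
  assert (Hm : forall y, l' zm <= l' y).
  { intros y. rewrite <- (Hext y). apply Hzm, Hclip. }
  assert (HM : forall y, l' y <= l' zM).
  { intros y. rewrite <- (Hext y). apply HzM, Hclip. }
  set (l := fun y => x0 + RInt l' y0 y).
  assert (Hd : forall y, is_derive l y (l' y)).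
  { intros y. replace (l' y) with (0 + l' y) by ring.
    apply (is_derive_plus (fun _ => x0)); [apply @is_derive_const|].
    apply (is_derive_RInt l' _ y0 y); [|apply Hc].
    apply filter_forall. intros t. apply (RInt_correct l').
    apply (ex_RInt_continuous l'). intros z _; apply Hc. }
  exists l, l', (l' zm), (l' zM). split; [|split; [exact Hd | split; [exact Hc | split; [exact Hm | split]]]].
  - split; [apply Hpos|]. intros s t Hst.
    destruct (MVT_gen l s t l') as (z & _ & ->).
    + intros y _; apply Hd.
    + intros y _. apply continuity_pt_filterlim, (ex_derive_continuous l).
      exists (l' y); apply Hd.
    + split; apply Rmult_le_compat_r; auto; lra.
  - unfold l. rewrite (RInt_point y0 l'). unfold zero; simpl. ring.
  - intros y Hy. split.
    + unfold l, ell. f_equal. apply RInt_ext. intros s Hs.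
      assert (Hs' : cc A B s).
      { apply (between_cc A B y0 y); [split; lra | assumption | lra]. }
      unfold l'. rewrite (Hfix s Hs'). reflexivity.
    + unfold l'. rewrite (Hfix y Hy). reflexivity.
Qed.

Lemma ell_inv_right_inverse (A B y0 x0 m M : R) (p r l : R -> R) :
  A <= B -> (forall y, continuous l y) -> bilipschitz l m M ->
  (forall y, cc A B y -> l y = ell p r y0 x0 y) ->
  right_inverse l (ell_inv A B p r y0 x0) A B.
Proof.
  intros HAB Hc Hl Heq x Hx. unfold ell_inv.
  assert (Hex : exists y, cc A B y /\ ell p r y0 x0 y = x).
  { destruct (IVT_gen l A B x) as (y & Hy & Hlx).
    - intros y; apply continuity_pt_filterlim, Hc.
    - unfold cc in Hx. rewrite Rmin_left, Rmax_right by lra. exact Hx.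
    - rewrite Rmin_left, Rmax_right in Hy by exact HAB.
      exists y. split; [exact Hy|]. rewrite <- Heq; auto. }
  destruct (epsilon_spec (inhabits 0) _ Hex) as [H1 H2].
  split; [exact H1|]. rewrite Heq by exact H1. exact H2.
Qed.

(** * Formal powers under the change of variable *)

Lemma inverse_continuous_on (l k : R -> R) (A B m M : R) :
  bilipschitz l m M -> right_inverse l k A B ->
  continuous_on (cc (l A) (l B)) k.
Proof.
  intros Hl Hk x Hx. pose proof Hl as [Hm _].
  apply filterlim_locally. intros eps.
  assert (Hd : 0 < m * eps) by (apply Rmult_lt_0_compat; [exact Hm | apply cond_pos]).
  exists (mkposreal _ Hd). intros z Hz Hcz.
  change (Rabs (z - x) < m * eps) in Hz. change (Rabs (k z - k x) < eps).
  assert (Hlip : Rabs (k z - k x) <= / m * Rabs (z - x)).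
  { destruct (Rle_dec x z) as [Hxz|Hxz].
    - destruct (inverse_increment l k A B m M Hl Hk x z) as [I1 I2]; auto.
      rewrite !Rabs_pos_eq by lra. exact I2.
    - destruct (inverse_increment l k A B m M Hl Hk z x) as [I1 I2]; auto; [lra|].
      rewrite !Rabs_left1 by lra. lra. }
  eapply Rle_lt_trans; [exact Hlip|]. apply Rmult_lt_reg_l with m; [exact Hm|].
  rewrite <- Rmult_assoc, Rinv_r by lra. lra.
Qed.

(** A weight in [x] whose pullback is continuous on the closed interval extends
    to a continuous weight on the line. *)
Lemma weight_extension (l l' k : R -> R) (A B m M : R) (v w : R -> C) :
  A <= B -> bilipschitz l m M -> right_inverse l k A B ->
  (forall y, continuous l' y) -> (forall y, m <= l' y) ->
  continuous_on (cc A B) w ->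
  (forall y, cc A B y -> (RtoC (l' y) * v (l y))%C = w y) ->
  exists v', (forall x, continuous (U := C_UniformSpace) v' x) /\
             (forall x, cc (l A) (l B) x -> v x = v' x).
Proof.
  intros HAB Hl Hk Hl' Hm Hw Hvw. pose proof Hl as [Hm0 _].
  assert (Hab : l A <= l B).
  { destruct (inverse_of_image l k A B m M Hl Hk A) as [[H _] _]; [unfold cc; lra|].
    apply (inverse_of_image l k A B m M Hl Hk B). unfold cc; lra. }
  set (k' := fun x => k (clip (l A) (l B) x)).
  assert (Hk' : forall x, continuous k' x).
  { apply continuous_clip; [exact Hab|]. apply inverse_continuous_on with m M; assumption. }
  exists (fun x => (RtoC (/ l' (k' x)) * w (clip A B (k' x)))%C). split.
  - intros x. apply continuous_Cmult.
    + apply continuous_RtoC.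
      apply (continuous_comp (fun x => l' (k' x)) Rinv).
      * apply (continuous_comp k' l'); auto.
      * apply continuous_Rinv. specialize (Hm (k' x)). lra.
    + apply (continuous_comp k' (fun y => w (clip A B y) : C_UniformSpace)); [apply Hk'|].
      apply (continuous_clip (U := C_UniformSpace)); assumption.
  - intros x Hx. destruct (Hk x Hx) as [Hc E].
    unfold k'. rewrite (clip_inside (l A) (l B) x) by exact Hx.
    rewrite (clip_inside A B (k x)) by exact Hc.
    rewrite <- Hvw, E by exact Hc.
    rewrite Cmult_assoc, <- RtoC_mult, Rinv_l, Cmult_1_l; [reflexivity|].
    specialize (Hm (k x)). lra.
Qed.

Lemma iterated_pullback (l l' k : R -> R) (A B m M y0 : R) (v1 v2 w1 w2 : R -> C) (n : nat) :
  bilipschitz l m M -> right_inverse l k A B ->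
  (forall y, is_derive l y (l' y)) -> (forall y, continuous l' y) -> (forall y, m <= l' y) ->
  continuous_on (cc A B) w1 -> continuous_on (cc A B) w2 ->
  (forall y, cc A B y -> (RtoC (l' y) * v1 (l y))%C = w1 y) ->
  (forall y, cc A B y -> (RtoC (l' y) * v2 (l y))%C = w2 y) ->
  cc A B y0 ->
  forall y, cc A B y -> iterated v1 v2 (l y0) n (l y) = iterated w1 w2 y0 n y.
Proof.
  intros Hl Hk Hd Hc Hm Hw1 Hw2 Hv1 Hv2 Hy0 y Hy.
  assert (HAB : A <= B) by (unfold cc in Hy; lra).
  destruct (weight_extension l l' k A B m M v1 w1) as (v1' & C1 & E1); auto.
  destruct (weight_extension l l' k A B m M v2 w2) as (v2' & C2 & E2); auto.
  assert (Him := fun y Hy => proj1 (inverse_of_image l k A B m M Hl Hk y Hy)).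
  rewrite (iterated_ext v1 v2 v1' v2' (l A) (l B)); auto.
  apply (iterated_substitution l l' v1' v2' w1 w2 A B); auto.
  - intros s Hs. rewrite <- E1; auto.
  - intros s Hs. rewrite <- E2; auto.
Qed.

(** * The Liouville transformation of a solution *)

Lemma pow4_inj (x y : R) : 0 < x -> 0 < y -> x ^ 4 = y ^ 4 -> x = y.
Proof.
  intros Hx Hy H.
  assert (Hf : (x - y) * ((x + y) * (x ^ 2 + y ^ 2)) = 0) by (simpl in *; nra).
  apply Rmult_integral in Hf as [Hf|Hf]; [lra|].
  assert (0 < (x + y) * (x ^ 2 + y ^ 2)) by (apply Rmult_lt_0_compat; nra). lra.
Qed.

Lemma Rpower_quarter_pow4 (z : R) : 0 < z -> Rpower z (1 / 4) ^ 4 = z.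
Proof.
  intros Hz. rewrite <- Rpower_pow by (apply exp_pos).
  rewrite Rpower_mult. replace (1 / 4 * INR 4) with 1 by (simpl; field).
  apply Rpower_1; exact Hz.
Qed.

Definition inv_rho (p r : R -> R) (y : R) : R := Rpower (p y * r y) (- (1 / 4)).

Definition inv_rho' (p r p1 r1 : R -> R) (y : R) : R :=
  - (1 / 4) * (inv_rho p r y * / p y * / r y) * (p1 y * r y + p y * r1 y).

Lemma rho_pos (p r : R -> R) (y : R) : 0 < rho p r y.
Proof. apply exp_pos. Qed.

Lemma inv_rho_eq (p r : R -> R) (y : R) : inv_rho p r y = / rho p r y.
Proof. apply Rpower_Ropp. Qed.

Lemma is_derive_inv_rho (p r p1 r1 : R -> R) (y : R) :
  0 < p y -> 0 < r y -> is_derive p y (p1 y) -> is_derive r y (r1 y) ->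
  is_derive (inv_rho p r) y (inv_rho' p r p1 r1 y).
Proof.
  intros Hp Hr Hdp Hdr. unfold inv_rho', inv_rho, Rpower.
  assert (0 < p y * r y) by (apply Rmult_lt_0_compat; assumption).
  auto_derive.
  - repeat split; [exists (p1 y) | exists (r1 y) |]; assumption.
  - replace (Derive (fun x : R => p x) y) with (p1 y)
      by (symmetry; apply is_derive_unique; exact Hdp).
    replace (Derive (fun x : R => r x) y) with (r1 y)
      by (symmetry; apply is_derive_unique; exact Hdr).
    field; split; lra.
Qed.

(** All quantities are positive, so the relations between these roots may be
    checked on squares and fourth powers. *)
Lemma liouville_factors (p r : R -> R) (y : R) :
  0 < p y -> 0 < r y ->
  let L := sqrt (r y / p y) in
  0 < L /\ rho p r y ^ 2 = L * p y /\ r y = L ^ 2 * p y /\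
  Rpower (/ (r y ^ 3) * p y) (1 / 4) * rho p r y = / L.
Proof.
  intros Hp Hr L.
  assert (Hq : 0 < r y / p y) by (apply Rdiv_lt_0_compat; assumption).
  assert (HL : 0 < L) by (apply sqrt_lt_R0; exact Hq).
  assert (HL2 : r y = L ^ 2 * p y).
  { unfold L. rewrite pow2_sqrt by lra. field; lra. }
  assert (Hrho := rho_pos p r y).
  assert (H4 : rho p r y ^ 4 = p y * r y).
  { apply Rpower_quarter_pow4, Rmult_lt_0_compat; assumption. }
  repeat split; auto.
  - assert (Hd : (rho p r y ^ 2 - L * p y) * (rho p r y ^ 2 + L * p y) = 0).
    { replace ((rho p r y ^ 2 - L * p y) * (rho p r y ^ 2 + L * p y))
        with (rho p r y ^ 4 - p y * (L ^ 2 * p y)) by ring.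
      rewrite H4, <- HL2. ring. }
    apply Rmult_integral in Hd as [Hd|Hd]; [lra|].
    assert (0 < L * p y) by (apply Rmult_lt_0_compat; assumption).
    assert (0 < rho p r y ^ 2) by (apply pow_lt; assumption). lra.
  - assert (Hr3 : 0 < r y ^ 3) by (apply pow_lt; exact Hr).
    assert (Ht : 0 < / (r y ^ 3) * p y).
    { apply Rmult_lt_0_compat; [apply Rinv_0_lt_compat|]; assumption. }
    apply pow4_inj.
    + apply Rmult_lt_0_compat; [apply exp_pos | exact Hrho].
    + apply Rinv_0_lt_compat; exact HL.
    + rewrite Rpow_mult_distr, (Rpower_quarter_pow4 _ Ht), H4, HL2. field. split; lra.
Qed.

(** The quotient rule for [u / h] leaves a factor [rho ^ 2] and the change of
    variable a factor [1 / L]; as [rho ^ 2 = L * p], what remains is the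
    Wronskian [p (u' h - u h')]. *)
Lemma is_derive_liouville (p r u k : R -> R) (x u' h' : R) :
  let y := k x in
  0 < p y -> 0 < r y ->
  is_derive k x (/ sqrt (r y / p y)) -> is_derive u y u' -> is_derive (inv_rho p r) y h' ->
  is_derive (fun t => rho p r (k t) * u (k t)) x
    (p y * u' * inv_rho p r y - u y * (p y * h')).
Proof.
  intros y Hp Hr Hk Hu Hh.
  destruct (liouville_factors p r y Hp Hr) as (HL & Hrho2 & _).
  set (L := sqrt (r y / p y)) in *.
  assert (Hrho := rho_pos p r y).
  assert (Hpos : inv_rho p r y <> 0) by (apply Rgt_not_eq, exp_pos).
  apply is_derive_ext with (fun t => u (k t) / inv_rho p r (k t)).
  { intros t. rewrite inv_rho_eq. unfold Rdiv. rewrite Rinv_inv. apply Rmult_comm. }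
  assert (Hd := is_derive_comp (fun z => u z / inv_rho p r z) k x _ _
                  (is_derive_div u (inv_rho p r) y u' h' Hu Hh Hpos) Hk).
  replace (p y * u' * inv_rho p r y - u y * (p y * h')) with
    (scal (/ L) ((u' * inv_rho p r y - u y * h') / inv_rho p r y ^ 2)); [exact Hd|].
  rewrite inv_rho_eq. unfold scal; simpl; unfold mult; simpl.
  replace (p y) with (rho p r y ^ 2 * / L) by (rewrite Hrho2; field; lra).
  field. split; lra.
Qed.

(** The products [p u' h'] cancel, so no second derivative of [u] or [h] occurs
    by itself. *)
Lemma is_derive_wronskian (p P u h w k : R -> R) (x L u' h' d w' : R) :
  let y := k x in
  P y = p y * u' -> w y = p y * h' ->
  is_derive k x (/ L) -> is_derive u y u' -> is_derive h y h' ->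
  is_derive P y d -> is_derive w y w' ->
  is_derive (fun t => P (k t) * h (k t) - u (k t) * w (k t)) x
    (/ L * (d * h y - u y * w')).
Proof.
  intros y HP Hw Hk Hu Hh HdP Hdw.
  assert (Hd := is_derive_comp (fun z => P z * h z - u z * w z) k x _ _
    (is_derive_minus (fun z => P z * h z) (fun z => u z * w z) y _ _
       (is_derive_mult P h y d h' HdP Hh Rmult_comm)
       (is_derive_mult u w y u' w' Hu Hdw Rmult_comm)) Hk).
  replace (/ L * (d * h y - u y * w')) with
    (scal (/ L) (minus (plus (mult d (h y)) (mult (P y) h'))
                       (plus (mult u' (w y)) (mult (u y) w')))); [exact Hd|].
  rewrite HP, Hw. unfold scal, minus, plus, opp, mult; simpl. unfold mult; simpl. ring.
Qed.

Lemma AC_loc_of_continuous_derive (h h' : R -> R) (A B : R) :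
  (forall y, A < y < B -> is_derive h y (h' y)) ->
  (forall y, A < y < B -> continuous h' y) -> AC_loc h A B.
Proof.
  intros Hd Hc c d HA Hcd HB. apply AC_of_continuous_derive with h'; [exact Hcd| |];
    intros y Hy; [apply Hd | apply Hc]; lra.
Qed.

Lemma locally_oo (A B y : R) : A < y < B -> locally y (fun t => A < t < B).
Proof.
  intros Hy.
  apply (open_and (fun t => A < t) (fun t => t < B)); [apply open_gt | apply open_lt | exact Hy].
Qed.

(** Having locally absolutely continuous derivatives, [p] and [r] are
    continuously differentiable, hence so is [1 / rho]; its derivative is a
    combination of [p'] and [r'] with continuously differentiable
    coefficients. *)
Lemma coefficient_regularity (A B : R) (p r : R -> R) :
  coefficients A B p r ->
  exists h' : R -> R,
    (forall y, A < y < B -> is_derive (inv_rho p r) y (h' y)) /\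
    AC_loc (inv_rho p r) A B /\ AC_loc (fun y => p y * h' y) A B.
Proof.
  intros ((HpAC & p1 & Hp1 & Hp1AC) & (HrAC & r1 & Hr1 & Hr1AC) & _ & _ & Hp0 & Hr0).
  assert (Hcc : forall y, A < y < B -> cc A B y) by (unfold cc; intros; lra).
  assert (Cp1 : forall y, A < y < B -> continuous p1 y) by (intros; apply (AC_loc_continuous p1 A B); auto).
  assert (Cr1 : forall y, A < y < B -> continuous r1 y) by (intros; apply (AC_loc_continuous r1 A B); auto).
  assert (Cp : forall y, A < y < B -> continuous p y) by (intros; apply (AC_loc_continuous p A B); auto).
  assert (Cr : forall y, A < y < B -> continuous r y) by (intros; apply (AC_loc_continuous r A B); auto).
  assert (Dp := AC_loc_is_derive p p1 A B HpAC Hp1 Cp1).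
  assert (Dr := AC_loc_is_derive r r1 A B HrAC Hr1 Cr1).
  assert (Dh : forall y, A < y < B -> is_derive (inv_rho p r) y (inv_rho' p r p1 r1 y)).
  { intros y Hy. apply is_derive_inv_rho; auto. }
  assert (Ch : forall y, A < y < B -> continuous (inv_rho p r) y).
  { intros y Hy. apply (ex_derive_continuous (inv_rho p r)). eexists; apply Dh; exact Hy. }
  assert (Cinv : forall (q : R -> R) (y : R), 0 < q y -> continuous q y -> continuous (fun t => / q t) y).
  { intros q y Hq Hc. apply (continuous_comp q Rinv); [exact Hc|].
    apply continuous_Rinv; lra. }
  assert (AC_h : AC_loc (inv_rho p r) A B).
  { apply AC_loc_of_continuous_derive with (inv_rho' p r p1 r1); [exact Dh|].
    intros y Hy. unfold inv_rho'.
    repeat first [ apply (continuous_mult (K := R_AbsRing))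
                 | apply (continuous_plus (V := R_NormedModule)) ];
      auto using continuous_const. }
  assert (AC_r : AC_loc (fun y => / r y) A B).
  { apply AC_loc_of_continuous_derive with (fun y => - r1 y / r y ^ 2).
    - intros y Hy. apply is_derive_inv; [auto|].
      apply Rgt_not_eq, Hr0, Hcc, Hy.
    - intros y Hy. apply (continuous_mult (K := R_AbsRing)).
      + apply (continuous_opp (V := R_NormedModule)); auto.
      + apply Cinv; [apply pow_lt; auto|]. simpl.
        repeat apply (continuous_mult (K := R_AbsRing)); auto using continuous_const. }
  exists (inv_rho' p r p1 r1). split; [exact Dh|]. split; [exact AC_h|].
  intros c d Hc Hcd Hd.
  apply AC_ext with
    (fun y => (- (1 / 4)) * (inv_rho p r y * / r y) * (p1 y * r y + p y * r1 y)).
  - intros y Hy. unfold inv_rho'. assert (0 < p y) by (apply Hp0; unfold cc; lra).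
    assert (0 < r y) by (apply Hr0; unfold cc; lra). eq_at R. field; split; lra.
  - apply AC_mult; [exact Hcd| |apply AC_plus; apply AC_mult; auto].
    apply AC_mult; [exact Hcd| |apply AC_mult; auto].
    apply AC_lipschitz with 0. intros s t _ _ _.
    change (Rabs (- (1 / 4) - - (1 / 4)) <= 0 * (t - s)).
    rewrite Rminus_diag, Rabs_R0. lra.
Qed.

(** The transformation is linear over the reals, so it is applied to the real
    and imaginary parts [u] of the solution separately; [p u'] enters only
    through its derivative [d] at points where that exists. *)
Lemma liouville_component (A B m M : R) (p r l k u u1 h' : R -> R) :
  bilipschitz l m M -> right_inverse l k A B ->
  (forall y, A < y < B -> is_derive l y (sqrt (r y / p y)) /\ m <= sqrt (r y / p y)) ->
  (forall y, A < y < B -> 0 < p y /\ 0 < r y /\ continuous p y) ->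
  (forall y, A < y < B -> is_derive (inv_rho p r) y (h' y)) ->
  AC_loc (inv_rho p r) A B -> AC_loc (fun y => p y * h' y) A B ->
  AC_loc u A B -> ae A B (fun y => is_derive u y (u1 y)) -> AC_loc (fun y => p y * u1 y) A B ->
  exists U1 : R -> R,
    AC_loc U1 (l A) (l B) /\
    (forall x, l A < x < l B -> is_derive (fun t => rho p r (k t) * u (k t)) x (U1 x)) /\
    (forall x d w', l A < x < l B -> let y := k x in
       is_derive (fun t => p t * u1 t) y d -> is_derive (fun t => p t * h' t) y w' ->
       is_derive U1 x (/ sqrt (r y / p y) * (d * inv_rho p r y - u y * w'))).
Proof.
  intros Hl Hk HL Hpr Hh AC_h AC_w AC_u Hae AC_P.
  assert (Hu : forall y, A < y < B -> is_derive u y (u1 y)).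
  { apply (AC_loc_is_derive u u1 A B AC_u Hae). intros y Hy.
    apply (continuous_ext_loc _ (fun t => (p t * u1 t) * / p t)).
    - apply (filter_imp (fun t => A < t < B)); [|apply locally_oo; exact Hy].
      intros t Ht. destruct (Hpr t Ht) as (H & _). eq_at R. field. lra.
    - apply (continuous_mult (K := R_AbsRing)).
      + apply (AC_loc_continuous _ A B y AC_P Hy).
      + destruct (Hpr y Hy) as (H & _ & Hc).
        apply (continuous_comp p Rinv); [exact Hc | apply continuous_Rinv; lra]. }
  assert (Hin := inverse_interior l k A B m M Hl Hk).
  assert (Hdk : forall x, l A < x < l B -> is_derive k x (/ sqrt (r (k x) / p (k x)))).
  { intros x Hx. destruct (HL (k x) (Hin x Hx)) as [H1 H2].
    apply (is_derive_inverse l k A B m M); auto. }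
  exists (fun x => p (k x) * u1 (k x) * inv_rho p r (k x) - u (k x) * (p (k x) * h' (k x))).
  split; [|split].
  - apply (AC_loc_comp_inverse (fun y => p y * u1 y * inv_rho p r y - u y * (p y * h' y))
             l k A B m M Hl Hk).
    intros c d Hc Hcd Hd. apply AC_minus; apply AC_mult; auto.
  - intros x Hx. destruct (Hpr (k x) (Hin x Hx)) as (Hp & Hr & _).
    apply is_derive_liouville; auto.
  - intros x d w' Hx y Hd Hw.
    apply (is_derive_wronskian p (fun t => p t * u1 t) u (inv_rho p r)
             (fun t => p t * h' t) k x _ (u1 y) (h' y)); auto; [apply Hu | apply Hh];
      apply Hin; exact Hx.
Qed.

Theorem theorem3p5 :
  forall (A B y0 x0 : R) (p r : R -> R) (q g f : R -> C),
  oo A B y0 ->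
  coefficients A B p r ->
  is_solution A B p q g ->
  (* division by zero is total, so that 1/(g^2 p) exists must be said *)
  (forall y, cc A B y -> g y <> RtoC 0) ->
  continuous_on (cc A B) (g2r r g) ->
  continuous_on (cc A B) (inv_g2p p g) ->
  (forall y, cc A B y ->
     f (ell p r y0 x0 y) = (RtoC (rho p r y) * g y)%C) ->
  let a := ell p r y0 x0 A in
  let b := ell p r y0 x0 B in
  is_solution a b (fun _ => 1) (potential A B p r q y0 x0) f /\
  (forall (n : nat) (y : R), cc A B y ->
     (RtoC (rho p r y) * Phi p r g y0 n y)%C = phi f x0 n (ell p r y0 x0 y)) /\
  (forall (n : nat) (x : R), cc a b x ->
     phi f x0 n x = Liouville A B p r y0 x0 (Phi p r g y0 n) x).
Proof.
  intros A B y0 x0 p r q g f Hy0 Hco Hg Hg0 Hg2r Hinv Hf a b.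
  pose proof Hco as (_ & _ & Cp & Cr & Hp0 & Hr0).
  destruct (ell_extension A B y0 x0 p r Hy0 Cp Cr Hp0 Hr0)
    as (l & l' & m & M & Hl & Hdl & Hcl' & Hml' & Hly0 & Hell).
  assert (HAB : A < B) by (unfold oo in Hy0; lra).
  assert (Hyc0 : cc A B y0) by (unfold oo in Hy0; unfold cc; lra).
  assert (Hoc : forall y, A < y < B -> cc A B y) by (unfold cc; intros; lra).
  assert (Hcl : forall y, continuous l y).
  { intros y. apply (ex_derive_continuous l). eexists; apply Hdl. }
  set (k := ell_inv A B p r y0 x0).
  assert (Hk : right_inverse l k A B).
  { apply (ell_inv_right_inverse A B y0 x0 m M p r l); auto; [lra|].
    intros y Hy; apply Hell; exact Hy. }
  replace a with (l A) by (apply Hell; unfold cc; lra).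
  replace b with (l B) by (apply Hell; unfold cc; lra).
  clear a b.
  assert (Hfl : forall y, cc A B y -> f (l y) = (RtoC (rho p r y) * g y)%C).
  { intros y Hy. rewrite (proj1 (Hell y Hy)). apply Hf; exact Hy. }
  assert (Hfk : forall x, cc (l A) (l B) x -> f x = (RtoC (rho p r (k x)) * g (k x))%C).
  { intros x Hx. destruct (Hk x Hx) as [H1 H2]. rewrite <- H2 at 1. apply Hfl; exact H1. }
  assert (Hpow : forall (n : nat) (y : R), cc A B y ->
     (RtoC (rho p r y) * Phi p r g y0 n y)%C = phi f x0 n (l y)).
  { assert (Hw1 : forall y, cc A B y -> (RtoC (l' y) * sq f (l y))%C = g2r r g y).
    { (* [rho ^ 2 * L = L ^ 2 * p = r] *)
      intros y Hy. unfold sq, g2r. rewrite Hfl, (proj2 (Hell y Hy)) by exact Hy.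
      destruct (liouville_factors p r y (Hp0 y Hy) (Hr0 y Hy)) as (HL & H2 & H3 & _).
      set (L := sqrt (r y / p y)) in *.
      rewrite H3. replace (L ^ 2 * p y) with (L * (rho p r y * rho p r y)) by (simpl in *; nra).
      rewrite !RtoC_mult. ring. }
    assert (Hw2 : forall y, cc A B y -> (RtoC (l' y) * inv_sq f (l y))%C = inv_g2p p g y).
    { (* [L / rho ^ 2 = 1 / p] *)
      intros y Hy. unfold inv_sq, inv_g2p. rewrite Hfl, (proj2 (Hell y Hy)) by exact Hy.
      destruct (liouville_factors p r y (Hp0 y Hy) (Hr0 y Hy)) as (HL & H2 & H3 & _).
      set (L := sqrt (r y / p y)) in *.
      assert (Hrho := rho_pos p r y). specialize (Hp0 y Hy).
      replace (p y) with (/ L * (rho p r y * rho p r y)) by (apply Rmult_eq_reg_l with L; [|lra];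
        rewrite <- Rmult_assoc, Rinv_r by lra; simpl in *; lra).
      rewrite !RtoC_mult, RtoC_inv by lra.
      assert (RtoC L <> RtoC 0) by (intros E; apply RtoC_inj in E; lra).
      assert (RtoC (rho p r y) <> RtoC 0) by (intros E; apply RtoC_inj in E; lra).
      field. repeat split; auto. }
    intros n y Hy. unfold Phi, phi. rewrite Hfl by exact Hy.
    rewrite Cmult_assoc. f_equal. symmetry.
    rewrite <- Hly0. unfold X, Xtilde, Y, Ytilde.
    destruct (Nat.odd n); apply (iterated_pullback l l' k A B m M); assumption. }
  split; [|split].
  - destruct (coefficient_regularity A B p r Hco) as (h' & Hh & AC_h & AC_w).
    destruct Hg as (ACg & g1 & Hg1 & ACP & Heq).
    assert (HL : forall y, A < y < B -> is_derive l y (sqrt (r y / p y)) /\ m <= sqrt (r y / p y)).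
    { intros y Hy. rewrite <- (proj2 (Hell y (Hoc y Hy))). auto. }
    assert (Hpr : forall y, A < y < B -> 0 < p y /\ 0 < r y /\ continuous p y).
    { intros y Hy. repeat split; auto.
      apply (AC_loc_continuous p A B); [apply Hco | exact Hy]. }
    destruct (liouville_component A B m M p r l k (fun y => fst (g y)) (fun y => fst (g1 y)) h')
      as (U & AC_U & HU & HU'); auto.
    { intros c d ? ? ?. apply (AC_C_iff g). apply ACg; assumption. }
    { revert Hg1. apply null_subset. intros y [Hy Hn]. split; [exact Hy|].
      intros Hd. apply Hn. apply (is_derive_C_iff g y) in Hd. apply Hd. }
    { intros c d ? ? ?. apply AC_ext with (fun y => fst (RtoC (p y) * g1 y)%C).
      - intros y _; simpl; eq_at R; ring.
      - apply (AC_C_iff (fun y => (RtoC (p y) * g1 y)%C)). apply ACP; assumption. }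
    destruct (liouville_component A B m M p r l k (fun y => snd (g y)) (fun y => snd (g1 y)) h')
      as (V & AC_V & HV & HV'); auto.
    { intros c d ? ? ?. apply (AC_C_iff g). apply ACg; assumption. }
    { revert Hg1. apply null_subset. intros y [Hy Hn]. split; [exact Hy|].
      intros Hd. apply Hn. apply (is_derive_C_iff g y) in Hd. apply Hd. }
    { intros c d ? ? ?. apply AC_ext with (fun y => snd (RtoC (p y) * g1 y)%C).
      - intros y _; simpl; eq_at R; ring.
      - apply (AC_C_iff (fun y => (RtoC (p y) * g1 y)%C)). apply ACP; assumption. }
    assert (Df : forall x, l A < x < l B ->
      is_derive (fun t => fst (f t)) x (U x) /\ is_derive (fun t => snd (f t)) x (V x)).
    { intros x Hx. assert (Hloc := locally_oo _ _ x Hx). split.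
      - apply (is_derive_ext_loc (fun t => rho p r (k t) * fst (g (k t)))); [|apply HU; exact Hx].
        revert Hloc. apply filter_imp. intros t Ht. rewrite Hfk by (unfold cc; lra). simpl. eq_at R. ring.
      - apply (is_derive_ext_loc (fun t => rho p r (k t) * snd (g (k t)))); [|apply HV; exact Hx].
        revert Hloc. apply filter_imp. intros t Ht. rewrite Hfk by (unfold cc; lra). simpl. eq_at R. ring. }
    split; [|exists (fun x => (U x, V x)); split; [|split]].
    + intros c d Hc Hcd Hd. apply AC_C_iff. split.
      * apply (AC_loc_of_continuous_derive _ U (l A) (l B)); try assumption; intros x Hx.
        -- apply Df; exact Hx.
        -- apply (AC_loc_continuous U (l A) (l B)); assumption.
      * apply (AC_loc_of_continuous_derive _ V (l A) (l B)); try assumption; intros x Hx.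
        -- apply Df; exact Hx.
        -- apply (AC_loc_continuous V (l A) (l B)); assumption.
    + apply null_empty. intros x [Hx Hn]. apply Hn. apply is_derive_C_iff. apply Df; exact Hx.
    + intros c d Hc Hcd Hd. apply AC_C_iff. split.
      * apply AC_ext with U; [intros x _; simpl; eq_at R; ring | apply AC_U; assumption].
      * apply AC_ext with V; [intros x _; simpl; eq_at R; ring | apply AC_V; assumption].
    + eapply null_subset; [|apply (null_image l m M _ Hl
        (null_union _ _ Heq (AC_loc_derivable_ae _ A B AC_w)))].
      intros x [Hx Hn]. exists (k x).
      split; [|symmetry; apply Hk; unfold oo in Hx; unfold cc; lra].
      assert (Hy := inverse_interior l k A B m M Hl Hk x Hx). set (y := k x) in *.
      apply Classical_Prop.NNPP. intros Hno. apply not_or_and in Hno as [Hgood Hw].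
      apply Hn; clear Hn.
      assert (Hd : exists d : C, is_derive (V := CR) (fun t => (RtoC (p t) * g1 t)%C) y d /\
                (d - q y * g y)%C = RtoC 0).
      { apply Classical_Prop.NNPP; intros Hn; apply Hgood; split; assumption. }
      assert (Hw' : ex_derive (fun t => p t * h' t) y).
      { apply Classical_Prop.NNPP; intros Hn; apply Hw; split; assumption. }
      clear Hgood Hw. destruct Hd as (d & Hd & Hdq). destruct Hw' as [w' Hw'].
      apply is_derive_C_iff in Hd as [Hd1 Hd2].
      assert (E1 : is_derive (fun t => p t * fst (g1 t)) y (fst d)).
      { revert Hd1. apply is_derive_ext. intros t; simpl; eq_at R; ring. }
      assert (E2 : is_derive (fun t => p t * snd (g1 t)) y (snd d)).
      { revert Hd2. apply is_derive_ext. intros t; simpl; eq_at R; ring. }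
      apply (HU' x (fst d) w' Hx) in E1; [|exact Hw'].
      apply (HV' x (snd d) w' Hx) in E2; [|exact Hw'].
      fold y in E1, E2.
      set (L := sqrt (r y / p y)) in *.
      exists (/ L * (fst d * inv_rho p r y - fst (g y) * w'),
              / L * (snd d * inv_rho p r y - snd (g y) * w')). split.
      * apply is_derive_C_iff. split; simpl.
        -- revert E1. apply is_derive_ext. intros t; eq_at R; ring.
        -- revert E2. apply is_derive_ext. intros t; eq_at R; ring.
      * unfold potential. fold k. fold y.
        assert (Hder : Derive (fun t => p t *
          Derive (fun s => Rpower (p s * r s) (- (1 / 4))) t) y = w').
        { apply is_derive_unique. revert Hw'. apply is_derive_ext_loc.
          apply (filter_imp (fun t => A < t < B)); [|apply locally_oo; exact Hy].
          intros t Ht. f_equal. symmetry. apply is_derive_unique, Hh; exact Ht. }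
        rewrite Hder. clear Hder.
        rewrite Hfk by (unfold oo in Hx; unfold cc; lra). fold y.
        destruct (liouville_factors p r y) as (HLp & H2 & H3 & H4); auto.
        fold L in HLp, H2, H3, H4.
        assert (Hrho := rho_pos p r y).
        assert (Hr' : / r y * rho p r y = / L * inv_rho p r y).
        { rewrite inv_rho_eq. replace (r y) with (L * rho p r y ^ 2) by (rewrite H2, H3; ring).
          field; split; lra. }
        set (tau := Rpower (/ (r y ^ 3) * p y) (1 / 4)) in *.
        assert (Hd' : d = (q y * g y)%C).
        { replace d with (d - q y * g y + q y * g y)%C by ring. rewrite Hdq. ring. }
        (* the coefficients of [d = q g] agree, and so do those of [w' g] *)
        transitivity (RtoC (/ L * inv_rho p r y) * d - RtoC (/ L * w') * g y -
          (RtoC (/ r y * rho p r y) * (q y * g y) - RtoC (tau * rho p r y * w') * g y))%C.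
        -- destruct d as [d1 d2], (g y) as [g1' g2'], (q y) as [q1 q2].
           apply injective_projections; simpl; ring.
        -- rewrite Hr', H4, Hd'. ring.
  - intros n y Hy. rewrite <- (proj1 (Hell y Hy)). apply Hpow; exact Hy.
  - intros n x Hx. destruct (Hk x Hx) as [H1 H2].
    unfold Liouville. fold k. rewrite Hpow by exact H1. rewrite H2. reflexivity.
Qed.
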